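(* Let $d$ and $r$ be positive integers with $1\leq r\leq \binom{d+2}{2}$, and let $q$ be a prime power with $q\geq d+1$. Then $$e_r(d,2;q)=f_r(d,2;q).$$
   Context: Let $\mathbb{F}_q$ be the finite field with $q$ elements and let $S_d(m,\mathbb{F}_q)$ be the $\mathbb{F}_q$-vector space of homogeneous polynomials of degree $d$ in $\mathbb{F}_q[x_0,\dots,x_m]$ (together with $0$), of dimension $\binom{m+d}{d}$. For $1\leq r\leq\binom{m+d}{d}$ define $$e_r(d,m;q):=\max\{|V(W)(\mathbb{F}_q)| : W\subseteq S_d(m,\mathbb{F}_q)\text{ a linear subspace},\ \dim(W)=r\},$$ where $V(W)(\mathbb{F}_q)\subseteq\mathbb{P}^m(\mathbb{F}_q)$ is the set of $\mathbb{F}_q$-points at which all polynomials of $W$ vanish. For integers $d,m\ge 0$ let $\Omega(d,m)=\{(\gamma_1,\dots,\gamma_{m+1})\in\mathbb{Z}_{\ge 0}^{m+1}:\sum_{i=1}^{m+1}\gamma_i=d\}$, ordered lexicographically. For $1\leq r\leq |\Omega(d,m)|=\binom{m+d}{d}$, let $\omega_r(d,m)=(\beta_1,\dots,\beta_{m+1})$ be its $r$-th largest element, and put $H_r(d,m;q):=\sum_{i=1}^m\beta_i q^{m-i}$. Let $\pi_m(q)=\frac{q^{m+1}-1}{q-1}$ for $m\ge 0$ and $\pi_m(q)=0$ for $m<0$. For positive integers $m,d,r$ with $1\leq r\leq\binom{m+d}{d}$, let $l$ be the unique integer $1\leq l\leq m+1$ with $\binom{m+d}{d}-\binom{m+d+1-l}{d}<r\leq\binom{m+d}{d}-\binom{m+d-l}{d}$,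 let $j=r-\binom{m+d}{d}+\binom{m+d+1-l}{d}$, and define $$f_r(d,m;q):=H_j(d-1,m-l+1;q)+\pi_{m-l}(q).$$ *)

(* Defs.v *)
From HB Require Import structures.
From mathcomp Require Import all_boot all_order all_algebra all_field.
From mathcomp Require Export mpoly.

Set Implicit Arguments.
Unset Strict Implicit.
Unset Printing Implicit Defensive.

Import Order.TTheory GRing.Theory.

(* A vector space over a finite field has finitely many subspaces, so that one
   can take cardinals of sets of subspaces and maxima over all subspaces. *)
Section FiniteVspace.
Import VectorInternalTheory.
Variables (F : finFieldType) (vT : vectType F).
HB.instance Definition _ := [Countable of {vspace vT} by <:].
HB.instance Definition _ := [Finite of {vspace vT} by <:].
End FiniteVspace.

(* P^m(F), a point being a line through the origin of F^(m+1). *)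
Definition proj_space (F : finFieldType) (m : nat) :
    {set {vspace 'rV[F]_m.+1}} :=
  [set L : {vspace 'rV[F]_m.+1} | \dim L == 1%N].

(* A form f vanishes at the point L when it vanishes at all representatives v
   of L.  finvect_type V is V itself, seen as a finite type. *)
Definition zero_locus (F : finFieldType) (d m : nat)
    (W : {vspace dhomog m.+1 F d}) : {set {vspace 'rV[F]_m.+1}} :=
  [set L in proj_space F m |
    [forall f : finvect_type (dhomog m.+1 F d), (f \in W) ==>
      [forall v : 'rV[F]_m.+1, (v \in L) ==>
        ((mpoly_of_dhomog f).@[v 0%R] == 0%R)]]].

Definition e_max (F : finFieldType) (r d m : nat) : nat :=
  \max_(W : {vspace dhomog m.+1 F d} | \dim W == r) #|zero_locus W|.

(* The entries of an element of Omega(d, m) are at most d, whence 'I_d.+1. *)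
Definition Omega (d m : nat) : {set m.+1.-tuplelexi 'I_d.+1} :=
  [set g : m.+1.-tuplelexi 'I_d.+1 | \sum_(i < m.+1) tnth g i == d].

(* r-th largest element, r counted from 1; the default value is irrelevant
   for 1 <= r <= #|Omega d m|. *)
Definition omega (r d m : nat) : m.+1.-tuplelexi 'I_d.+1 :=
  nth [tuple ord0 | i < m.+1] (sort >=%O (enum (Omega d m))) r.-1.

(* beta_i is the entry of index i - 1 of omega r d m. *)
Definition H_val (r d m q : nat) : nat :=
  \sum_(1 <= i < m.+1) nth ord0 (omega r d m) i.-1 * q ^ (m - i).

(* The division is exact for q >= 2. *)
Definition pi_proj (m : int) (q : nat) : nat :=
  match m with
  | Posz n => (q ^ n.+1 - 1) %/ (q - 1)
  | Negz _ => 0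
  end.

(* The integer l such that 1 <= l <= m + 1 and
   C(m+d,d) - C(m+d+1-l,d) < r <= C(m+d,d) - C(m+d-l,d);
   for d > 0 and 1 <= r <= C(m+d,d) the filtered list has exactly one item,
   and no subtraction is truncated. *)
Definition level (r d m : nat) : nat :=
  head 0 [seq l <- iota 1 m.+1 |
           'C(m + d, d) - 'C(m + d + 1 - l, d) < r
             <= 'C(m + d, d) - 'C(m + d - l, d)].

Definition f_val (r d m q : nat) : nat :=
  let l := level r d m in
  let j := r - ('C(m + d, d) - 'C(m + d + 1 - l, d)) in
  H_val j (d - 1) (m + 1 - l) q + pi_proj (m%:Z - l%:Z)%R q.

(* Main.v *)
From HB Require Import structures.
Require Import Defs.
From mathcomp Require Import all_boot all_order all_algebra all_field.
From mathcomp Require Import zify ring.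

Set Implicit Arguments.
Unset Strict Implicit.
Unset Printing Implicit Defensive.

Import GRing.Theory.

(** Write r = C(a+1, 2) + b + 1 with b <= a <= d; then the claimed maximum is
    (d - a) q + [a < d] + (a - b).

    Lower bound: a product g of d - a concurrent lines has (d - a) q + [a < d]
    points, and the forms g h, with h of degree a vanishing at a - b further
    points, make up a space of dimension at least r.

    Upper bound: let W have dimension r and choose coordinates such that some
    member of W does not vanish at P = (0 : 0 : 1).  Restrict the forms to the
    generic line x1 = t x0 through P, that is, view f(1, t, u) as a polynomial
    in u over K = F(t).  By Gauss's lemma the gcd over K of these restrictions
    comes from a form G over F, say of degree e, and W = G W'.  Counting on the
    lines through a point of multiplicity m of G gives Serre's bound e q + 1 for
    the zeros of G.

    For the n common zeros of W', of degree d' = d - e, put the generic line at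
    infinity.  The zeros become n points of the affine plane over K; let h_k be
    the dimension of the space of functions on them given by polynomials of
    degree < k, and J_k the space of degree k forms whose values on the points
    are also those of a polynomial of degree < k, identified with polynomials in
    u.  Then h_(k+1) = h_k + k + 1 - dim J_k, and J_k, u J_k lie in J_(k+1).  As
    J_d' contains the restrictions of W', its members have no common divisor;
    hence dim J_(k+1) >= dim J_k + 2 for k >= d' until J_k is everything, and
    summing up gives n <= (d' - a) (d' + 1) + (a - b), where d' + 1 <= q. *)

(** * Spaces of binary forms and their multiples *)

Section ShiftDim.
Local Open Scope ring_scope.
Variables (K : fieldType) (k : nat).

(** A row of length k + 1 stands for a binary form of degree k, written as a polynomial in one
    variable; [padmx] and [shiftmx] are multiplication by the two variables of the form. *)
Definition padmx : 'M[K]_(k.+1, k.+2) := lin1_mx (poly_rV \o rVpoly).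
Definition shiftmx : 'M[K]_(k.+1, k.+2) := lin1_mx (poly_rV \o ('X \o* rVpoly)).

Lemma size_rVpoly (m : nat) (v : 'rV[K]_m) : (size (rVpoly v) <= m)%N.
Proof. exact: size_poly. Qed.

Lemma rVpoly_inj (m : nat) : injective (@rVpoly K m).
Proof. exact: can_inj (@rVpolyK K m). Qed.

Lemma rVpoly_eq0 (m : nat) (v : 'rV[K]_m) : (rVpoly v == 0) = (v == 0).
Proof. by rewrite -(inj_eq (@rVpoly_inj m)) linear0. Qed.

Lemma padmxK (v : 'rV_k.+1) : rVpoly (v *m padmx) = rVpoly v.
Proof. by rewrite mul_rV_lin1 /= poly_rV_K // leqW // size_rVpoly. Qed.

Lemma shiftmxK (v : 'rV_k.+1) : rVpoly (v *m shiftmx) = rVpoly v * 'X.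
Proof.
rewrite mul_rV_lin1 /= poly_rV_K // (leq_trans (size_polyMleq _ _)) //.
by rewrite size_polyX addn2 /= ltnS size_rVpoly.
Qed.

Lemma padmx_free : row_free padmx.
Proof.
apply: inj_row_free => v /eqP; rewrite -rVpoly_eq0 padmxK rVpoly_eq0.
by move=> /eqP.
Qed.

Lemma shiftmx_free : row_free shiftmx.
Proof.
apply: inj_row_free => v /eqP; rewrite -rVpoly_eq0 shiftmxK.
by rewrite mulf_eq0 polyX_eq0 orbF rVpoly_eq0 => /eqP.
Qed.

Lemma submx_pid_size (m s : nat) (v : 'rV[K]_m) :
  (v <= (pid_mx s : 'M_m))%MS = (size (rVpoly v) <= s)%N.
Proof.
apply/idP/idP => [/submxP[w ->]|vs].
  apply/leq_sizeP => j sj; rewrite coef_rVpoly; case: insubP => // i _ ij.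
  rewrite mxE big1 // => i' _; rewrite mxE.
  by case: eqP => [->|]; rewrite ?mulr0 // ltnNge ij sj mulr0.
apply/submxP; exists v; apply/rowP => i; rewrite mxE (bigD1 i) //= big1 => [|j ji].
  rewrite mxE eqxx /= addr0; case: ltnP => [_|si]; first by rewrite mulr1.
  by rewrite mulr0 -coef_rVpoly_ord nth_default // (leq_trans vs).
by move: ji; rewrite mxE -val_eqE /= => /negbTE->; rewrite mulr0.
Qed.

(** By [submx_pid_size] the rows of size at most s form a row space, so it is decidable whether A
    contains a nonzero one, and [ex_minn] finds the least s. *)
Lemma exists_min_size (m n : nat) (A : 'M[K]_(m, n)) : A != 0 ->
  exists v : 'rV[K]_n, [/\ (v <= A)%MS, v != 0 &
    forall w : 'rV_n, (w <= A)%MS -> w != 0 ->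
      (size (rVpoly v) <= size (rVpoly w))%N].
Proof.
move=> /rowV0Pn [v vA v0].
pose P s := (A :&: (pid_mx s : 'M_n))%MS != 0.
have PE w : (w <= A)%MS -> w != 0 -> P (size (rVpoly w)).
  move=> wA w0; apply/rowV0Pn; exists w => //.
  by rewrite sub_capmx wA submx_pid_size /=.
have ex : exists s, P s by exists (size (rVpoly v)); apply: PE.
case: (ex_minnP ex) => s /rowV0Pn[w]; rewrite sub_capmx => /andP[wA ws] w0 smin.
exists w; split=> // u uA u0; apply: (@leq_trans s); last exact/smin/PE.
by rewrite -submx_pid_size.
Qed.

Variables (J : 'M[K]_k.+1) (J' : 'M[K]_k.+2).
Hypothesis padJ : (J *m padmx <= J')%MS.
Hypothesis shiftJ : (J *m shiftmx <= J')%MS.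

(** Otherwise the padded copy of J lies in the shifted one, and a nonzero element of J of least
    degree is 'X times an element of J of smaller degree. *)
Lemma shift_rank_gt : (0 < \rank J)%N -> (\rank J < \rank J')%N.
Proof.
rewrite lt0n mxrank_eq0 => /exists_min_size[v [vJ v0 vmin]].
rewrite -(mxrankMfree J shiftmx_free).
apply: (@leq_trans (\rank (J *m padmx + J *m shiftmx)%MS)); last first.
  by apply: mxrankS; rewrite addsmx_sub padJ.
rewrite ltnNge; apply/negP => le.
have := mxrank_leqif_sup (addsmxSr (J *m padmx) (J *m shiftmx)).
move=> /geq_leqif; rewrite le addsmx_sub => /esym/andP[/submxP[M JM] _].
have /submxP[w Ew] : (v *m padmx <= J *m shiftmx)%MS.
  by apply: submx_trans (submxMr _ vJ) _; rewrite JM submxMl.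
rewrite mulmxA in Ew.
have wJ : (w *m J <= J)%MS by rewrite submxMl.
have/(congr1 rVpoly) := Ew; rewrite padmxK shiftmxK => Ev.
have w0 : w *m J != 0.
  by apply: contraNneq v0 => wJ0; rewrite -rVpoly_eq0 Ev wJ0 linear0 mul0r.
by have := vmin _ wJ w0; rewrite Ev size_mulX ?rVpoly_eq0 // ltnn.
Qed.

Hypothesis J_deg : exists2 v : 'rV[K]_k.+1, (v <= J)%MS & v 0 ord_max != 0.
Hypothesis J_gcd : forall g : {poly K},
  (forall v : 'rV[K]_k.+1, (v <= J)%MS -> g %| rVpoly v) -> (size g <= 1)%N.

(* If the dimension grows only by one, then J contains 'X * g for all g in J of
   degree < k, and so an element of least degree divides all of J. *)
Lemma shift_rank_gt2 : ((\rank J).+2 <= \rank J')%N \/ \rank J = k.+1.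
Proof.
have [|lt] := leqP (\rank J).+2 (\rank J'); [by left | right].
have [f fJ f0] := J_deg.
pose lc : 'M[K]_(k.+1, 1) := delta_mx ord_max 0.
have lcE (v : 'rV_k.+1) : v *m lc = (v 0 ord_max)%:M.
  apply/matrixP => i j; rewrite !ord1 mxE (bigD1 ord_max) //= big1 => [|i' ii'].
    by rewrite !mxE !eqxx mulr1 addr0.
  by rewrite !mxE (negbTE ii') mulr0.
(* [J0] consists of the elements of J of degree less than k; since f has degree k, it is a
   hyperplane of J. *)
pose J0 := (J :&: kermx lc)%MS.
have rJ0 : (\rank J <= (\rank J0).+1)%N.
  by have := mxrank_mul_ker J lc; have := rank_leq_col (J *m lc); rewrite /J0; lia.
pose A := J *m padmx; pose B := J *m shiftmx.
have rA : \rank A = \rank J by rewrite mxrankMfree ?padmx_free.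
have rB : \rank B = \rank J by rewrite mxrankMfree ?shiftmx_free.
have rAB : (\rank (A + B)%MS <= (\rank J).+1)%N.
  by rewrite -ltnS (leq_trans _ lt) // ltnS mxrankS // addsmx_sub padJ.
have rcap : (\rank J <= (\rank (A :&: B)%MS).+1)%N.
  by have := mxrank_sum_cap A B; rewrite rA rB; lia.
have lcA (v : 'rV_k.+1) : (v *m shiftmx <= A)%MS -> v 0 ord_max = 0.
  case/submxP => M /(congr1 rVpoly); rewrite mulmxA padmxK shiftmxK.
  move=> /(congr1 (fun p : {poly K} => p`_k.+1)); rewrite coefMX /=.
  rewrite -[k in X in X = _]/(val (@ord_max k)) coef_rVpoly_ord => ->.
  by rewrite nth_default // size_rVpoly.
have capJ0 : (A :&: B <= J0 *m shiftmx)%MS.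
  apply/rV_subP => w; rewrite sub_capmx => /andP[wA /submxP[M wM]].
  rewrite wM mulmxA submxMr // sub_capmx submxMl.
  by apply/sub_kermxP; rewrite lcE lcA ?raddf0 // -mulmxA -wM.
(* The inclusion [capJ0] is an equality for reasons of dimension: the intersection has dimension at
   least dim J - 1 by [rcap], and [J0] is a proper subspace of J. *)
have J0A : (J0 *m shiftmx <= A)%MS.
  apply: submx_trans (capmxSl A B).
  rewrite -(mxrank_leqif_sup capJ0) mxrankMfree ?shiftmx_free //.
  rewrite eqn_leq (leq_trans (mxrankS capJ0)) ?mxrankMfree ?shiftmx_free //=.
  rewrite -ltnS; apply: leq_trans rcap;
    rewrite /J0 (ltn_leqif (mxrank_leqif_sup (capmxSl J (kermx lc)))).
  apply/negP; rewrite sub_capmx submx_refl /= => /(submx_trans fJ)/sub_kermxP.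
  by rewrite lcE => /matrixP/(_ 0 0)/eqP; rewrite !mxE eqxx mulr1n (negbTE f0).
have shiftV (v : 'rV_k.+1) : (v <= J)%MS -> (size (rVpoly v) <= k)%N ->
    exists2 w : 'rV_k.+1, (w <= J)%MS & rVpoly w = rVpoly v * 'X.
  move=> vJ vk; have /submxP[M] : (v *m shiftmx <= A)%MS.
    apply: submx_trans J0A; apply: submxMr; rewrite sub_capmx vJ /=.
    apply/sub_kermxP; rewrite lcE -coef_rVpoly_ord nth_default ?raddf0 //.
  by rewrite mulmxA => /(congr1 rVpoly); rewrite padmxK shiftmxK => E;
    exists (M *m J); rewrite ?submxMl.
have Jn0 : J != 0.
  by apply: contraNneq f0 => J0'; move: fJ; rewrite J0' => /submx0null->; rewrite mxE.
have [g [gJ g0 gmin]] := exists_min_size Jn0.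
have shiftn i : (size (rVpoly g) + i <= k.+1)%N ->
    (poly_rV (rVpoly g * 'X^i) <= J)%MS.
  elim: i => [_|i IH gi]; first by rewrite mulr1 rVpolyK.
  have sgi : (size (rVpoly g * 'X^i)%R <= k)%N.
    by rewrite size_mulXn ?rVpoly_eq0 //; lia.
  have gJi : (poly_rV (rVpoly g * 'X^i) <= J)%MS by apply: IH; lia.
  have [|w wJ wE] := shiftV _ gJi; first by rewrite poly_rV_K // leqW.
  by rewrite exprSr mulrA -(@poly_rV_K _ k.+1 (_ * 'X^i)) ?leqW // -wE rVpolyK.
(* Divide by g: the multiple of g lies in J by [shiftn], hence so does the remainder, which is
   smaller than g and therefore zero. *)
have gdvd (v : 'rV_k.+1) : (v <= J)%MS -> rVpoly g %| rVpoly v.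
  move=> vJ; have [->|v0] := eqVneq v 0; first by rewrite linear0 dvdp0.
  have gv := gmin v vJ v0; have gp : rVpoly g != 0 by rewrite rVpoly_eq0.
  have vE := divp_eq (rVpoly v) (rVpoly g).
  set q := _ %/ _ in vE; set r := _ %% _ in vE.
  have rg : (size r < size (rVpoly g))%N by rewrite ltn_modp.
  have qs : (size q + size (rVpoly g) <= k.+2)%N.
    have yp : (0 < size (rVpoly g))%N by rewrite size_poly_gt0.
    rewrite size_divp // -{2}(prednK yp) addnS subnK ?ltnS ?size_rVpoly //.
    by rewrite (leq_trans (leq_pred _)).
  have qJ : (poly_rV (q * rVpoly g) <= J)%MS.
    rewrite -[q]coefK poly_def mulr_suml linear_sum summx_sub // => i _.
    rewrite -scalerAl linearZ /= scalemx_sub // mulrC shiftn //.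
    by rewrite -ltnS (leq_trans _ qs) // addnC -addSn leq_add2r ltn_ord.
  have rE : poly_rV r = v - poly_rV (q * rVpoly g).
    by rewrite -[v in RHS]rVpolyK -linearB vE /= addrC addKr.
  have rJ : (poly_rV r <= J)%MS by rewrite rE addmx_sub // eqmx_opp.
  rewrite vE dvdp_addr ?dvdp_mull //.
  have [r0|/(gmin _ rJ)] := eqVneq (poly_rV r : 'rV_k.+1) 0.
    by rewrite -(@poly_rV_K _ k.+1 r) ?r0 ?linear0 ?dvdp0 // (leq_trans (ltnW rg)) ?size_rVpoly.
  rewrite poly_rV_K ?(leq_trans (ltnW rg)) ?size_rVpoly // => /(leq_trans rg).
  by rewrite ltnn.
(* Once g is a nonzero constant, its shifts are all the monomials, so that J is the whole space. *)
have g1 : size (rVpoly g) = 1%N.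
  apply/eqP; rewrite eqn_leq size_poly_gt0 rVpoly_eq0 g0 andbT.
  exact: J_gcd.
apply/eqP; rewrite -[_ == _]/(row_full J) -sub1mx; apply/row_subP => i.
have /size_poly1P[c c0 gc] : size (rVpoly g) == 1%N by rewrite g1.
have := shiftn i; rewrite g1 gc => /(_ (ltn_ord i)).
rewrite mul_polyC linearZ /= (eqmx_scale _ c0).
suff -> : poly_rV 'X^i = row i (1%:M : 'M[K]_k.+1) by [].
by apply/rowP => j; rewrite !mxE coefXn eq_sym.
Qed.
End ShiftDim.

(** * Hilbert functions of finite sets of points in the plane *)

Lemma bin2_split (m : nat) : 'C(m.+1, 2) = 'C(m, 2) + m.
Proof. by rewrite binS bin1 addnC. Qed.

Lemma bin2_add (m n : nat) : 'C(m + n, 2) = 'C(m, 2) + 'C(n, 2) + m * n.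
Proof.
elim: n => [|n IH]; first by rewrite muln0 (@bin_small 0) // !addn0.
by rewrite addnS !bin2_split IH mulnS; lia. Qed.

Lemma leq_bin2 (m n : nat) : m <= n -> 'C(m, 2) <= 'C(n, 2).
Proof. by move=> /subnKC <-; rewrite bin2_add -addnA leq_addr. Qed.

(* In the application h k is h_k and w k is the dimension of J_k. *)
Section HilbertNumbers.
Variables (h w : nat -> nat) (d : nat).
Hypothesis h0 : h 0 = 0.
Hypothesis hw : forall k, h k.+1 + w k = h k + k.+1.
Hypothesis w_le : forall k, w k <= k.+1.
Hypothesis w_gt : forall k, 0 < w k -> w k < w k.+1.
Hypothesis w_gt2 : forall k, d <= k -> (w k).+2 <= w k.+1 \/ w k = k.+1.

Let S k := \sum_(j < k) w j.

Let S0 : S 0 = 0. Proof. by rewrite /S big_ord0. Qed.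

Let S_rec k : S k.+1 = S k + w k. Proof. by rewrite /S big_ord_recr. Qed.

Let hS k : h k + S k = 'C(k.+1, 2).
Proof.
elim: k => [|k IH]; first by rewrite h0 S0.
by rewrite S_rec bin2_split -IH; move: (S k) (hw k) => ?; lia.
Qed.

(** The positive values of w increase strictly, so going down from w k they are at most w k, w k -
    1, and so on. *)
Let S_le k : S k.+1 <= 'C((w k).+1, 2).
Proof.
elim: k => [|k IH]; first by rewrite S_rec S0 bin2_split leq_addl.
rewrite S_rec [in leqRHS]bin2_split leq_add2r (leq_trans IH) //.
have [->//|w0] := posnP (w k); exact: leq_bin2 (w_gt w0).
Qed.

(** Put c k = k + 1 - w k, the growth of h from k to k + 1. From d on, c drops by at least one at
    each step until it is zero, so h grows beyond h (d + 1) by at most (c d - 1) + (c d - 2) + ... +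
    1. *)
Let h_tail m :
  h (d.+1 + m) + 'C((d + m).+1 - w (d + m), 2) <= h d.+1 + 'C(d.+1 - w d, 2).
Proof.
elim: m => [|m IH]; first by rewrite !addn0.
apply: leq_trans IH; rewrite !addnS addSn.
have dm : d <= d + m by lia.
have := hw (d + m).+1; have := w_le (d + m).+1; have := w_le (d + m).
case: (w_gt2 dm) => [ww|wE] w1 w2.
  have -> : (d + m).+1 - w (d + m) = ((d + m).+1 - w (d + m)).-1.+1 by lia.
  rewrite bin2_split => hE.
  have : 'C((d + m).+2 - w (d + m).+1, 2) <= 'C(((d + m).+1 - w (d + m)).-1, 2).
    by apply: leq_bin2; lia.
  lia.
have := w_gt (_ : 0 < w (d + m)); rewrite wE subnn => /(_ isT) w3.
rewrite (_ : (d + m).+2 - w (d + m).+1 = 0); lia.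
Qed.

(** The bound on h (d + 1) forces the sum of w 0, ..., w d above C(a + 1, 2), hence w d > a by
    [S_le]. Then c d is at most d - a and the tail adds at most C(d - a, 2). *)
Lemma hilbert_bound (a b n N : nat) : b <= a ->
  h d.+1 + ('C(a.+1, 2) + b.+1) <= 'C(d.+2, 2) -> n <= h N ->
  a <= d /\ n <= (d - a) * d.+1 + (a - b).
Proof.
move=> ba hd nN.
have ad : a <= d.
  rewrite leqNgt; apply/negP => /(leq_bin2 (m := d.+2) (n := a.+1)); lia.
split=> //; have wa : a < w d.
  rewrite ltnNge; apply/negP => /(leq_bin2 (m := (w d).+1) (n := a.+1)).
  by have := S_le d; have := hS d.+1; lia.
(* N may be smaller than d + 1; monotonicity moves it into the range of [h_tail]. *)
have h_mono m : h m <= h (d.+1 + m).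
  rewrite addnC; elim: d.+1 => [|i IH]; first by rewrite addn0.
  by rewrite addnS (leq_trans IH) //; have := hw (m + i); have := w_le (m + i); lia.
have nE : n <= h d.+1 + 'C(d - a, 2).
  apply: leq_trans nN _; apply: leq_trans (h_mono N) _.
  apply: (leq_trans (leq_addr _ _) (leq_trans (h_tail N) _)).
  by rewrite leq_add2l leq_bin2 //; have := w_le d; lia.
(* With c = d - a the estimates add up exactly: C(d + 2, 2) - C(a + 1, 2) - (b + 1) + C(c, 2) = c (d
   + 1) + (a - b). *)
move: hd nE; rewrite -(subnKC ad); move: (d - a) => c; rewrite addKn => hd nE.
have sq : 'C(c, 2) + 'C(c, 2) + c = c * c.
  by elim: c {hd nE} => // c IH; rewrite bin2_split; nia.
have : 'C((a + c).+2, 2) = 'C(a.+1, 2) + a.+1 + 'C(c, 2) + a.+2 * c.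
  by rewrite -!addSn bin2_add -bin2_split.
rewrite (_ : a.+2 * c = a * c + c + c); last by rewrite !mulSn; lia.
rewrite (_ : c * (a + c).+1 = a * c + c * c + c);
  last by rewrite mulnS mulnDr (mulnC c a); lia.
move: sq hd nE; move: (c * c) (a * c) => x y.
by move: (h _) 'C(a.+1, 2) 'C(c, 2) 'C(_, 2) => *; lia.
Qed.

End HilbertNumbers.

(** * Values of polynomials at finitely many points of the affine plane *)

Section PlanePoints.
Local Open Scope ring_scope.
Variables (K : fieldType) (n : nat) (x z : 'I_n -> K).

Definition top_eval (k : nat) : 'M[K]_(k.+1, n) :=
  \matrix_(j, i) (x i ^+ (k - j) * z i ^+ j).

(* The values of the polynomials of degree < k, not <= k. *)
Fixpoint eval_space (k : nat) : 'M[K]_n :=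
  if k is k'.+1 then (eval_space k' + top_eval k')%MS else 0.

(** This is J_k: the leading forms of degree k of the polynomials vanishing at all the points, a
    form being given by its coefficients at x^(k - j) z^j. *)
Definition lead_space (k : nat) : 'M[K]_k.+1 :=
  kermx (top_eval k *m cokermx (eval_space k)).

Let Dx : 'M[K]_n := diag_mx (\row_i x i).
Let Dz : 'M[K]_n := diag_mx (\row_i z i).

Lemma top_evalE (k : nat) (v : 'rV_k.+1) (i : 'I_n) :
  (v *m top_eval k) 0 i =
  \sum_(j < k.+1) (rVpoly v)`_j * (x i ^+ (k - j) * z i ^+ j).
Proof. by rewrite mxE; apply: eq_bigr => j _; rewrite coef_rVpoly_ord !mxE. Qed.

Lemma lead_spaceE (k : nat) (v : 'rV_k.+1) :
  (v <= lead_space k)%MS = (v *m top_eval k <= eval_space k)%MS.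
Proof. by rewrite sub_kermx submxE mulmxA. Qed.

(** Multiplying a form by x multiplies its values by the diagonal matrix of the x-coordinates;
    [shiftmx_top_eval] is the same for z. Hence both multiples of J_k lie in the next space. *)
Lemma padmx_top_eval (k : nat) : padmx K k *m top_eval k.+1 = top_eval k *m Dx.
Proof.
apply/row_matrixP => l; rewrite !rowE !mulmxA; set v := delta_mx _ _.
apply/rowP => i; rewrite top_evalE padmxK big_ord_recr /=.
rewrite [_`_k.+1]nth_default ?size_rVpoly // mul0r addr0.
rewrite mul_mx_diag mxE top_evalE mxE mulr_suml; apply: eq_bigr => j _.
by rewrite subSn ?exprS; [ring | rewrite -ltnS].
Qed.

Lemma shiftmx_top_eval (k : nat) :
  shiftmx K k *m top_eval k.+1 = top_eval k *m Dz.
Proof.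
apply/row_matrixP => l; rewrite !rowE !mulmxA; set v := delta_mx _ _.
apply/rowP => i; rewrite top_evalE shiftmxK big_ord_recl /= coefMX mul0r add0r.
rewrite mul_mx_diag mxE top_evalE mxE mulr_suml; apply: eq_bigr => j _.
by rewrite coefMX /= subSS exprS; ring.
Qed.

Lemma eval_space_Dx (k : nat) : (eval_space k *m Dx <= eval_space k.+1)%MS.
Proof.
elim: k => [|k IH]; first by rewrite mul0mx sub0mx.
rewrite [in X in (X <= _)%MS]/= addsmxMr addsmx_sub.
rewrite (submx_trans IH (addsmxSl _ _)) -padmx_top_eval.
exact: submx_trans (submxMl _ _) (addsmxSr _ _).
Qed.

Lemma eval_space_Dz (k : nat) : (eval_space k *m Dz <= eval_space k.+1)%MS.
Proof.
elim: k => [|k IH]; first by rewrite mul0mx sub0mx.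
rewrite [in X in (X <= _)%MS]/= addsmxMr addsmx_sub.
rewrite (submx_trans IH (addsmxSl _ _)) -shiftmx_top_eval.
exact: submx_trans (submxMl _ _) (addsmxSr _ _).
Qed.

Lemma eval_spaceS (k : nat) : (eval_space k <= eval_space k.+1)%MS.
Proof. exact: addsmxSl. Qed.

Lemma lead_space_pad (k : nat) : (lead_space k *m padmx K k <= lead_space k.+1)%MS.
Proof.
apply/row_subP => l; rewrite row_mul lead_spaceE -mulmxA padmx_top_eval mulmxA.
apply: submx_trans (eval_space_Dx k); apply: submxMr.
by rewrite -lead_spaceE row_sub.
Qed.

Lemma lead_space_shift (k : nat) :
  (lead_space k *m shiftmx K k <= lead_space k.+1)%MS.
Proof.
apply/row_subP => l; rewrite row_mul lead_spaceE -mulmxA shiftmx_top_eval mulmxA.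
apply: submx_trans (eval_space_Dz k); apply: submxMr.
by rewrite -lead_spaceE row_sub.
Qed.

(** The gain in dimension is the rank of [top_eval] modulo [eval_space], and [lead_space] is the
    kernel of that map. *)
Lemma rank_eval_spaceS (k : nat) :
  (\rank (eval_space k.+1) + \rank (lead_space k) = \rank (eval_space k) + k.+1)%N.
Proof.
rewrite mxrank_ker /= -/(eval_space k).
have := mxrank_mul_ker (top_eval k) (cokermx (eval_space k)).
have := mxrank_sum_cap (eval_space k) (top_eval k).
have -> : \rank (top_eval k :&: kermx (cokermx (eval_space k)))%MS =
          \rank (eval_space k :&: top_eval k)%MS.
  apply: eqmx_rank; apply/rV_eqP => v.
  by rewrite !sub_capmx sub_kermx -submxE andbC.
have := rank_leq_row (top_eval k);
  have := rank_leq_row (top_eval k *m cokermx (eval_space k)).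
by lia.
Qed.

Hypothesis xz_inj : forall i j, x i = x j -> z i = z j -> i = j.

(** For each j in s some coordinate differs at i and j; subtracting its value at j gives a linear
    factor that vanishes at j but not at i. The product of these factors has degree [size s]. *)
Lemma eval_space_separates (i : 'I_n) (s : seq 'I_n) : i \notin s ->
  exists v : 'rV_n, [/\ (v <= eval_space (size s).+1)%MS, v 0 i != 0 &
    forall j, j \in s -> v 0 j = 0].
Proof.
elim: s => [_|j s IH].
  exists (row 0 (top_eval 0)); split=> //.
    exact: submx_trans (row_sub _ _) (addsmxSr _ _).
  by rewrite !mxE /= mul1r oner_neq0.
rewrite inE negb_or => /andP[ij /IH[v [vE vi vs]]].
have step (D : 'M[K]_n) (t : 'I_n -> K) :
    (forall k, (eval_space k *m D <= eval_space k.+1)%MS) ->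
    (forall w : 'rV_n, forall l, (w *m D) 0 l = w 0 l * t l) -> t i != t j ->
    exists v : 'rV_n, [/\ (v <= eval_space (size (j :: s)).+1)%MS, v 0 i != 0 &
      forall l, l \in j :: s -> v 0 l = 0].
  move=> ED Dt tij; exists (v *m D - t j *: v).
  have vE' l : (v *m D - t j *: v) 0 l = v 0 l * (t l - t j).
    by rewrite mxE Dt ![in X in _ + X]mxE; ring.
  split; [| |move=> l].
  - rewrite addmx_sub ?eqmx_opp ?scalemx_sub //=.
      exact: submx_trans (submxMr _ vE) (ED _).
    exact: submx_trans vE (eval_spaceS _).
  - by rewrite vE' mulf_neq0 ?subr_eq0.
  by rewrite inE vE' => /orP[/eqP->|/vs->]; rewrite ?subrr ?mulr0 ?mul0r.
have [xij|xij] := eqVneq (x i) (x j); last first.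
  apply: step eval_space_Dx _ xij => w l.
  by rewrite mul_mx_diag !mxE.
apply: (step _ z eval_space_Dz) => [w l|]; first by rewrite mul_mx_diag !mxE.
by apply: contra ij => /eqP zij; apply/eqP/xz_inj.
Qed.

(** Separating i from all other points takes n - 1 linear factors, so every unit row comes from a
    polynomial of degree less than n. *)
Lemma eval_space_full : (n <= \rank (eval_space n))%N.
Proof.
suff : (1%:M <= eval_space n)%MS by rewrite sub1mx row_full_unit -row_free_unit => /eqP->.
apply/row_subP => i; rewrite row1.
have [|v [vE vi vj]] := @eval_space_separates i (rem i (enum 'I_n)).
  by rewrite mem_rem_uniq ?enum_uniq // inE eqxx.
rewrite size_rem ?mem_enum // size_enum_ord prednK ?(leq_ltn_trans _ (ltn_ord i)) // in vE.
have vE' : v = v 0 i *: delta_mx 0 i.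
  apply/rowP => j; rewrite !mxE eqxx /=; have [->|ji] := eqVneq j i.
    by rewrite mulr1.
  by rewrite mulr0 vj // mem_rem_uniq ?enum_uniq // inE ji mem_enum.
by move: vE; rewrite vE' (eqmx_scale _ vi).
Qed.

Section Bound.
Variables (d : nat) (P : {poly K} -> Prop).
Hypothesis P_size : forall p, P p -> (size p <= d.+1)%N.
Hypothesis P_lead : forall p, P p -> (poly_rV p <= lead_space d)%MS.
Hypothesis P_deg : exists2 p, P p & size p = d.+1.
Hypothesis P_gcd : forall g, (forall p, P p -> g %| p) -> (size g <= 1)%N.

(** Padding leaves the polynomial unchanged, so all of P stays in J_k for k >= d and the absence of
    a common divisor persists. Shifting, below, provides an element of full degree in each of these
    spaces. *)
Let P_lead_pad m p : P p -> (poly_rV p <= lead_space (d + m))%MS.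
Proof.
move=> Pp; elim: m => [|m IH]; first by rewrite addn0 P_lead.
rewrite addnS; apply: submx_trans (lead_space_pad (d + m)).
suff -> : poly_rV p = poly_rV p *m padmx K (d + m) by apply: submxMr.
apply: rVpoly_inj; rewrite padmxK !poly_rV_K //.
  by rewrite (leq_trans (P_size Pp)) // ltnS leq_addr.
by rewrite (leq_trans (P_size Pp)) // ltnS -addnS leq_addr.
Qed.

Let P_deg_shift m : exists2 v : 'rV_(d + m).+1,
  (v <= lead_space (d + m))%MS & v 0 ord_max != 0.
Proof.
suff [v vJ sv] : exists2 v : 'rV_(d + m).+1, (v <= lead_space (d + m))%MS &
    size (rVpoly v) = (d + m).+1.
  exists v => //; suff : lead_coef (rVpoly v) != 0.
    by rewrite lead_coefE sv -coef_rVpoly_ord.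
  by rewrite lead_coef_eq0 -size_poly_gt0 sv.
elim: m => [|m [v vJ sv]].
  have [p Pp sp] := P_deg; rewrite addn0; exists (poly_rV p); first exact: P_lead.
  by rewrite poly_rV_K sp.
rewrite addnS; exists (v *m shiftmx K _).
  exact: submx_trans (submxMr _ vJ) (lead_space_shift _).
by rewrite shiftmxK size_mulX ?sv // -size_poly_gt0 sv.
Qed.

Lemma plane_points_bound (a b : nat) : (b <= a)%N ->
  (\rank (eval_space d.+1) + ('C(a.+1, 2) + b.+1) <= 'C(d.+2, 2))%N ->
  (a <= d)%N /\ (n <= (d - a) * d.+1 + (a - b))%N.
Proof.
move=> ba rd.
apply: (@hilbert_bound (fun k => \rank (eval_space k))
          (fun k => \rank (lead_space k))) ba rd eval_space_full.
- exact: mxrank0.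
- exact: rank_eval_spaceS.
- by move=> k; apply: rank_leq_row.
- by move=> k; apply: shift_rank_gt;
  [apply: lead_space_pad | apply: lead_space_shift].
move=> k /subnKC <-; apply: shift_rank_gt2.
- exact: lead_space_pad.
- exact: lead_space_shift.
- exact: P_deg_shift.
move=> g gdvd; apply: P_gcd => p Pp; have := gdvd _ (P_lead_pad _ Pp).
rewrite poly_rV_K // (leq_trans (P_size Pp)) // ltnS leq_addr //.
Qed.
End Bound.
End PlanePoints.

(** * Gauss's lemma over F[t] *)

Section Gauss.
Local Open Scope ring_scope.
Variable F : fieldType.
Local Notation K := {fraction {poly F}}.
Local Notation tofrac := (@FracField.tofrac {poly F}).
Local Notation iota := (map_poly tofrac).

Lemma fraction_repr (y : K) : exists u v : {poly F}, v != 0 /\ tofrac v * y = tofrac u.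
Proof.
elim/quotW: y => r; exists (frac r).1, (frac r).2; split; first exact: denom_ratioP.
apply/eqP; rewrite !piE FracField.equivfE /=.
rewrite !numden_Ratio ?oner_neq0 ?mulf_neq0 ?mul1r ?denom_ratioP ?oner_neq0 //.
by rewrite mulr1 mulrC.
Qed.

Lemma fraction_poly_repr (g : {poly K}) :
  exists2 c : {poly F}, c != 0 & exists A, iota A = tofrac c *: g.
Proof.
elim/poly_ind: g => [|g y [c c0 [A EA]]].
  by exists 1; rewrite ?oner_neq0 //; exists 0; rewrite scaler0 rmorph0.
have [u [v [v0 Ev]]] := fraction_repr y.
exists (c * v); first by rewrite mulf_neq0.
exists (v *: A * 'X + (c * u)%:P).
have cuE : tofrac (c * u) = tofrac (c * v) * y.
  by rewrite tofracM -Ev mulrA -tofracM.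
rewrite rmorphD rmorphM /= map_polyX map_polyC /= map_polyZ /= EA cuE polyCM mul_polyC.
by rewrite scalerDr -!scalerAl scalerA -tofracM [v * c]mulrC.
Qed.

(* p plays the role of an irreducible factor of c, which need not be computable. *)
Lemma coprime_or_dvd_all (c : {poly F}) (s : seq {poly F}) : (size c != 1)%N ->
  exists2 p, (p %| c) && (size p != 1)%N &
    (forall i, p %| s`_i) \/
    (exists2 i, coprimep p s`_i & forall j, (j < i)%N -> p %| s`_j).
Proof.
elim: s c => [|y s IH] c c1.
  by exists c; rewrite ?dvdpp //; left=> i; rewrite nth_nil dvdp0.
have [cy|ncy] := boolP (coprimep c y).
  by exists c; rewrite ?dvdpp //; right; exists 0%N.
have [p /andP[pg p1] pP] := IH _ ncy; move: pg; rewrite dvdp_gcd => /andP[pc py].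
exists p; first by rewrite pc.
case: pP => [ps|[i pi pj]]; [left=> -[|i] //=|right; exists i.+1 => // -[|j] //=].
exact: pj.
Qed.

(** If A_i and B_j are the first coefficients not divisible by p and by its factor r, the
    coefficient of index i + j is A_i B_j modulo r. As r is coprime to B_j it would divide A_i, to
    which p is coprime. *)
Lemma dvd_product_coef (c : {poly F}) (A B : {poly {poly F}}) :
  (size c != 1)%N -> (forall i, c %| (A * B)`_i) ->
  exists2 p, (p %| c) && (size p != 1)%N &
    (forall i, p %| A`_i) \/ (forall i, p %| B`_i).
Proof.
move=> c1 cAB; have [p /andP[pc p1] [|[i pAi pAj]]] := coprime_or_dvd_all A c1.
  by exists p; rewrite ?pc //; left.
have [r /andP[rp r1] [|[j rBj rBk]]] := coprime_or_dvd_all B p1.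
  by exists r; rewrite ?(dvdp_trans rp pc) //; right.
suff : r %| A`_i * B`_j.
  rewrite Gauss_dvdpl // => rA; have := coprimep_dvdr rp pAi.
  by rewrite /coprimep (eqp_size (dvdp_gcd_idl rA)) (negbTE r1).
have := dvdp_trans (dvdp_trans rp pc) (cAB (i + j)%N); rewrite coefM.
have ij : (i < (i + j).+1)%N by rewrite ltnS leq_addr.
rewrite (bigD1 (Ordinal ij)) //= addKn dvdp_addl //.
apply: (big_ind (fun u => r %| u)) => [|u v|k ki]; [exact: dvdp0|exact: dvdp_add|].
have [lt|] := ltnP k i; first by rewrite dvdp_mulr // (dvdp_trans rp) // pAj.
rewrite leq_eqVlt => /orP[|lt];
  first by rewrite eq_sym -[_ == _]/(k == Ordinal ij) (negbTE ki).
by rewrite dvdp_mull // rBk //; have := ltn_ord k; lia.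
Qed.

Lemma poly_scale_dvd (p : {poly F}) (A : {poly {poly F}}) :
  (forall i, p %| A`_i) -> exists A', A = p *: A'.
Proof.
move=> pA; exists (\poly_(i < size A) (A`_i %/ p)); apply/polyP => i.
rewrite coefZ coef_poly; case: ltnP => [_|/leq_sizeP->//]; last by rewrite mulr0.
by rewrite mulrC divpK.
Qed.

(** Induction on the degree of c: a nonconstant factor of c divides A or B and is cancelled there.
    The factors taken from A are collected in c1. *)
Lemma gauss_factor (c : {poly F}) (f A B : {poly {poly F}}) : c != 0 ->
  c *: f = A * B ->
  exists c1 A' B', [/\ c1 != 0, A = c1 *: A' & f = A' * B'].
Proof.
have [s] := ubnP (size c); elim: s => // s IH in c A B * => cs c0 E.
have [/eqP/size_poly1P[u u0 cu]|c1] := eqVneq (size c) 1%N.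
  exists 1, A, (u^-1%:P *: B); rewrite oner_neq0 scale1r; split=> //.
  by rewrite -scalerAr -E cu scalerA -polyCM mulVf ?scale1r.
have [i|p /andP[/dvdpP[c' c'E] p1] pAB] := @dvd_product_coef c A B c1.
  by rewrite -E coefZ dvdp_mulr.
have p0 : p != 0 by apply: contraNneq c0 => p0; rewrite c'E p0 mulr0.
have c'0 : c' != 0 by apply: contraNneq c0 => c0; rewrite c'E c0 mul0r.
have c's : (size c' < s)%N.
  rewrite -ltnS (leq_trans _ cs) // ltnS c'E size_mul //.
  have := size_poly_gt0 p; rewrite p0; case: (size p) p1 => // -[|m] // _ _.
  by rewrite !addnS /= ltnS leq_addr.
have pI : injective (fun D : {poly {poly F}} => p *: D).
  by move=> D1 D2 /eqP; rewrite -!mul_polyC (inj_eq (mulfI _)) ?polyC_eq0 // => /eqP.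
case: pAB => /poly_scale_dvd[D DE].
  have [|c1' [A' [B' [c1n0 AE fE]]]] := IH c' D B c's c'0.
    by apply: pI; rewrite scalerA mulrC -c'E E DE scalerAl.
  by exists (p * c1'), A', B'; rewrite mulf_neq0 // DE AE scalerA.
apply: (IH c' A D) => //.
by apply: pI; rewrite scalerA mulrC -c'E E DE scalerAr.
Qed.

Lemma tofrac_inj : injective tofrac.
Proof. by move=> u v /eqP; rewrite tofrac_eq => /eqP. Qed.

Lemma iota_inj : injective iota.
Proof. by apply: map_inj_poly; [apply: tofrac_inj | apply: rmorph0]. Qed.

(** Clear the denominators of g and its cofactor and apply [gauss_factor]. As the leading
    coefficient of f is a nonzero constant, so is that of A', and A' made monic is a monic multiple
    of g over K, hence g itself. *)
Lemma monic_factor_lift (f : {poly {poly F}}) (u : F) (g : {poly K}) :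
  u != 0 -> lead_coef f = u%:P -> g \is monic -> g %| iota f ->
  exists2 G, G \is monic & iota G = g.
Proof.
move=> u0 lf gm /dvdpP[h fE].
have [c c0 [A AE]] := fraction_poly_repr g.
have [e e0 [B BE]] := fraction_poly_repr h.
have [||c1 [A' [B' [c10 A'E f'E]]]] := @gauss_factor (c * e) f A B _ _.
- by rewrite mulf_neq0.
- apply: iota_inj; rewrite rmorphM /= map_polyZ /= AE BE fE rmorphM.
  by rewrite -scalerAl -scalerAr scalerA [g * h]mulrC.
have : lead_coef A' * lead_coef B' = u%:P by rewrite -lead_coefM -f'E.
move=> /(congr1 (fun p : {poly F} => size p)).
rewrite size_polyC u0 => lAB.
have lA0 : lead_coef A' != 0.
  by apply: contra_eq_neq lAB => ->; rewrite mul0r size_poly0.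
have lB0 : lead_coef B' != 0.
  by apply: contra_eq_neq lAB => ->; rewrite mulr0 size_poly0.
have /size_poly1P[w w0 lA] : size (lead_coef A') == 1%N.
  move: lAB; rewrite size_mul // (polySpred lA0) (polySpred lB0) addnS addSn /=.
  by move=> [] /eqP; rewrite addn_eq0 => /andP[/eqP->].
have Gm : w^-1%:P *: A' \is monic.
  by rewrite monicE lead_coefZ lA -polyCM mulVf.
exists (w^-1%:P *: A') => //.
have gE : tofrac c *: g = tofrac (c1 * w%:P) *: iota (w^-1%:P *: A').
  rewrite -AE A'E !map_polyZ /= scalerA -rmorphM -mulrA -polyCM mulfV //.
  by rewrite mulr1.
have /eqP Gm1 := monicP Gm.
have iGm : iota (w^-1%:P *: A') \is monic.
  rewrite monicE lead_coef_map_inj; [|exact: tofrac_inj|exact: tofrac0].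
  by rewrite (eqP Gm1) tofrac1 eqxx.
have /(congr1 (fun p : {poly K} => lead_coef p)) := gE.
rewrite !lead_coefZ (monicP gm) (monicP iGm) !mulr1 => cE.
by move: gE; rewrite cE => /scalerI-> //; rewrite -cE tofrac_eq0.
Qed.

(* G is the gcd of the family over F(t): a monic divisor of f0 over F(t) is
   defined over F[t]. *)
Lemma monic_common_divisor (W : seq {poly {poly F}}) f0 (u : F) :
  f0 \in W -> u != 0 -> lead_coef f0 = u%:P ->
  exists2 G, G \is monic &
    (forall f, f \in W -> exists Q, f = G * Q) /\
    (forall g : {poly K},
       (forall f Q, f \in W -> f = G * Q -> g %| iota Q) -> (size g <= 1)%N).
Proof.
move=> f0W u0 lf0.
have f0n0 : iota f0 != 0.
  rewrite -(rmorph0 iota) (inj_eq iota_inj) -lead_coef_eq0 lf0 polyC_eq0.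
  exact: u0.
pose g := foldr (@gcdp K) 0 [seq iota f | f <- W].
have gP h : (h %| g) = all (fun f => h %| iota f) W.
  rewrite /g; elim: (W) => [|f W' IH] /=; first by rewrite dvdp0.
  by rewrite dvdp_gcd IH.
have gW f : f \in W -> g %| iota f.
  by move=> fW; have := dvdpp g; rewrite gP => /allP/(_ f fW).
have g0 : g != 0.
  by apply: contraNneq f0n0 => g0; have := gW _ f0W; rewrite g0 dvd0p.
have lg0 : (lead_coef g)^-1 != 0 by rewrite invr_neq0 ?lead_coef_eq0.
have [||G Gm EG] := @monic_factor_lift f0 u ((lead_coef g)^-1 *: g) u0 lf0.
- by rewrite monicE lead_coefZ mulVf ?lead_coef_eq0 ?eqxx.
- by rewrite dvdpZl // gW.
have iG h : (h %| iota G) = (h %| g) by rewrite EG dvdpZr.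
have iG' h : (iota G %| h) = (g %| h) by rewrite EG dvdpZl.
have iota_eq0 (f : {poly {poly F}}) : (iota f == 0) = (f == 0).
  by rewrite -{1}(rmorph0 iota) (inj_eq iota_inj).
have GQ f : f \in W -> exists Q, f = G * Q.
  (* G being monic, the division takes place over F[t]; the remainder is divisible by G over F(t)
     but has smaller degree, so it is zero. *)
  move=> fW; have fE := Pdiv.IdomainMonic.divp_eq Gm f.
  have := gW f fW; rewrite -iG' fE rmorphD rmorphM /= dvdp_addr ?dvdp_mull //.
  have [r0|r0 /dvdp_leq] := eqVneq (f %% G) 0.
    by exists (f %/ G); move: fE; rewrite r0 addr0 mulrC.
  rewrite iota_eq0 => /(_ r0).
  rewrite !size_map_inj_poly ?rmorph0 //; try exact: tofrac_inj.
  by rewrite leqNgt Pdiv.CommonIdomain.ltn_modp monic_neq0.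
exists G => //; split=> // h hQ.
have G0 : iota G != 0 by rewrite iota_eq0 monic_neq0.
(* A common divisor h of all cofactors makes h G a common divisor of the family, hence a divisor of
   G up to a unit. *)
have : h * iota G %| g.
  rewrite gP; apply/allP => f fW; have [Q fE] := GQ f fW.
  by rewrite fE rmorphM mulrC dvdp_mul // (hQ f).
rewrite -iG => hG; have h0 : h != 0.
  by apply: contraNneq G0 => h0; move: hG; rewrite h0 mul0r dvd0p.
have := dvdp_leq G0 hG; rewrite size_mul // (polySpred G0) addnS /=.
by rewrite -[X in (_ <= X)%N]add1n leq_add2r.
Qed.

End Gauss.

(** * Total degree and ternary forms *)

Section TotalDegree.
Local Open Scope ring_scope.
Variable F : fieldType.
Local Notation cf f i := (nth (0%R : {poly F}) (polyseq f%R) i%N).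
Implicit Types f g : {poly {poly F}}.

Definition tdeg_le (d : nat) f :=
  forall i, (cf f i) != 0%R -> (size (cf f i) + i <= d.+1)%N.

(* i is the last index at which the total degree D is attained, so that the
   corresponding terms of a product do not cancel. *)
Lemma tdeg_exact f : f != 0 ->
  exists D i, [/\ (cf f i) != 0%R, size (cf f i) + i = D.+1, tdeg_le D f &
    forall k, (i < k)%N -> (cf f k) != 0%R -> size (cf f k) + k <= D]%N.
Proof.
move=> f0; pose N := size f.
have N0 : (0 < N)%N by rewrite size_poly_gt0.
have iN k : (cf f k) != 0%R -> (k < N)%N.
  by apply: contraNltn => Nk; rewrite nth_default.
have i0 : cf f N.-1 != 0 by rewrite -lead_coefE lead_coef_eq0.
(* As k < N, [key] compares total degrees first and indices second. *)
pose key (k : 'I_N) := ((size (cf f k) + k) * N + k)%N.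
have i0' : cf f (Ordinal (iN _ i0)) != 0 by [].
case: (arg_maxnP (P := fun k : 'I_N => (cf f k) != 0%R) key i0') => i fi imax.
exists (size (cf f i) + i).-1, i.
have si : (0 < size (cf f i))%N by rewrite size_poly_gt0.
have kle k : (cf f k) != 0%R -> ((size (cf f k) + k) * N + k <= (size (cf f i) + i) * N + i)%N.
  by move=> fk; have := imax (Ordinal (iN _ fk)) fk.
have iltN := ltn_ord i.
have E : (size (cf f i) + i).-1.+1 = (size (cf f i) + i)%N by rewrite prednK // addn_gt0 si.
split=> // [k fk|k ik fk]; rewrite ?E.
  have := kle k fk; have := iN k fk.
  move: (size (cf f k) + k)%N (size (cf f i) + i)%N (nat_of_ord i) iltN; clear; nia.
rewrite -ltnS E; have := kle k fk; have := iN k fk.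
move: (size (cf f k) + k)%N (size (cf f i) + i)%N (nat_of_ord i) iltN ik; clear; nia.
Qed.

(** In the coefficient of index i + j of f g, every product other than that of indices i and j has a
    factor beyond i or beyond j, where the total degree is not attained. So the top term
    survives. *)
Lemma tdeg_mul f g D E i j :
  (cf f i) != 0%R -> (size (cf f i) + i = D.+1)%N -> tdeg_le D f ->
  (forall k, i < k -> (cf f k) != 0%R -> size (cf f k) + k <= D)%N ->
  (cf g j) != 0%R -> (size (cf g j) + j = E.+1)%N -> tdeg_le E g ->
  (forall k, j < k -> (cf g k) != 0%R -> size (cf g k) + k <= E)%N ->
  forall d, tdeg_le d (f * g) -> (D + E <= d)%N.
Proof.
move=> fi sfi fD fgt gj sgj gE ggt d fgd.
have ij : (i < (i + j).+1)%N by rewrite ltnS leq_addr.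
have sfg : size ((cf f i) * (cf g j)) = (D + E - (i + j)).+1%N.
  rewrite size_mul //; move: sfi sgj fi gj; rewrite -!size_poly_gt0.
  by move: (size _) (size _) => u v; clear; lia.
have cE : cf (f * g) (i + j) = (cf f i) * (cf g j) +
    \sum_(k < (i + j).+1 | k != Ordinal ij) (cf f k) * (cf g (i + j - k)).
  by rewrite coefM (bigD1 (Ordinal ij)) //= addKn.
have : (size (\sum_(k < (i + j).+1 | k != Ordinal ij) (cf f k) * (cf g (i + j - k)))%R <
        size ((cf f i) * (cf g j))%R)%N.
  rewrite sfg ltnS; apply: (leq_trans (size_sum _ _ _)); apply/bigmax_leqP => k ki.
  have [->|fk] := eqVneq (cf f k) 0; first by rewrite mul0r size_poly0.
  have [->|gk] := eqVneq (cf g (i + j - k)) 0; first by rewrite mulr0 size_poly0.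
  rewrite size_mul //; have := fD _ fk; have := gE _ gk; have kij := ltn_ord k.
  have : nat_of_ord k <> i by move=> kE; case/eqP: ki; apply: val_inj.
  have := fgt k; have := ggt (i + j - k)%N; rewrite fk gk.
  move: fk gk; rewrite -!size_poly_gt0 => fk gk fk' gk'.
  move: (size _) (size _) fk gk fk' gk' kij => u v; clear -ij.
  lia.
move=> /size_polyDl; rewrite -cE sfg => sE.
have := fgd (i + j)%N; rewrite -size_poly_gt0 sE => /(_ isT).
by clear; lia.
Qed.

(** The total degrees of G and Q0 are at least their degrees e and d - e in u, and they add up to at
    most d; so that of G is exactly e, and dividing by G lowers total degrees by e. *)
Lemma tdeg_le_factor f0 G (Q0 : {poly {poly F}}) (d e : nat) :
  G \is monic -> size G = e.+1 -> tdeg_le d f0 -> size f0 = d.+1 -> f0 = G * Q0 ->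
  [/\ (e <= d)%N, tdeg_le e G &
      forall Q, tdeg_le d (G * Q) -> tdeg_le (d - e) Q].
Proof.
move=> Gm sG f0d sf0 f0E.
have G0 : G != 0 by rewrite monic_neq0.
have f00 : f0 != 0 by rewrite -size_poly_eq0 sf0.
have Q00 : Q0 != 0 by apply: contraNneq f00 => Q0'; rewrite f0E Q0' mulr0.
have [D [i [Gi sGi GD Ggt]]] := tdeg_exact G0.
have [E [j [Qj sQj QE Qgt]]] := tdeg_exact Q00.
have sQ0 : size Q0 = (d - e).+1.
  have := size_mul G0 Q00; rewrite -f0E sf0 sG (polySpred Q00) addSn addnS /=.
  by move=> [->]; rewrite addKn.
have ed : (e <= d)%N.
  have := size_mul G0 Q00; rewrite -f0E sf0 sG (polySpred Q00) addSn addnS /=.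
  by move=> [->]; rewrite leq_addr.
have eD : (e <= D)%N.
  have : lead_coef G != 0 by rewrite lead_coef_eq0.
  rewrite lead_coefE sG /= => Ge; have := GD e Ge; rewrite -size_poly_gt0 in Ge.
  by move: (size _) Ge => u; clear; lia.
have deE : (d - e <= E)%N.
  have : lead_coef Q0 != 0 by rewrite lead_coef_eq0.
  rewrite lead_coefE sQ0 /= => Qe; have := QE _ Qe; rewrite -size_poly_gt0 in Qe.
  by move: (size _) Qe => u; clear; lia.
have DE : (D + E <= d)%N.
  by apply: (tdeg_mul Gi sGi GD Ggt Qj sQj QE Qgt); rewrite -f0E.
have DeE : D = e by lia.
split=> //; first by rewrite -DeE.
move=> Q GQd; have [->|Qn0] := eqVneq Q 0; first by move=> k; rewrite coef0 eqxx.
have [E' [j' [Qj' sQj' QE' Qgt']]] := tdeg_exact Qn0.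
have DE' := tdeg_mul Gi sGi GD Ggt Qj' sQj' QE' Qgt' GQd.
move=> k /QE' le; apply: leq_trans le _; clear -DE' DeE; lia.
Qed.
End TotalDegree.

(** * Ternary forms as polynomials in t and u *)

Section Forms.
Local Open Scope ring_scope.
Variable F : fieldType.
Local Notation cf f i := (nth (0%R : {poly F}) (polyseq f%R) i%N).
Local Notation i0 := (ord0 : 'I_3).
Local Notation i1 := (lift ord0 ord0 : 'I_3).
Local Notation i2 := (lift ord0 (lift ord0 ord0) : 'I_3).

Definition pt (S : nzRingType) (a b c : S) : 'I_3 -> S := fun i => nth 0 [:: a; b;
  c] i.

Lemma big_ord3 (R : Type) (idx : R) (op : Monoid.law idx) (G : 'I_3 -> R) :
  \big[op/idx]_(i < 3) G i = op (op (G i0) (G i1)) (G i2).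
Proof. by rewrite !big_ord_recl big_ord0 Monoid.mulm1 Monoid.mulmA. Qed.

Lemma ord3P (Q : 'I_3 -> Prop) : Q i0 -> Q i1 -> Q i2 -> forall i, Q i.
Proof.
move=> Q0 Q1 Q2 [[|[|[|//]]] i_lt].
- by rewrite (_ : Ordinal _ = i0) //; apply: val_inj.
- by rewrite (_ : Ordinal _ = i1) //; apply: val_inj.
by rewrite (_ : Ordinal _ = i2) //; apply: val_inj.
Qed.

Definition mexp (a b c : nat) : 'X_{1..3} := [multinom nth 0%N [:: a; b;
  c] i | i < 3].

Lemma mdeg_mexp a b c : mdeg (mexp a b c) = (a + b + c)%N.
Proof. by rewrite mdegE big_ord3 !mnmE. Qed.

Lemma mexpE (m : 'X_{1..3}) : m = mexp (m i0) (m i1) (m i2).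
Proof. by apply/mnmP; apply: ord3P; rewrite mnmE. Qed.

Lemma dhomog_ind (n d : nat) (Q : {mpoly F[n]} -> Prop) :
  Q 0 -> (forall c m g, mdeg m = d -> Q g -> Q (c *: 'X_[m] + g)) ->
  forall f, f \is d.-homog -> Q f.
Proof.
move=> Q0 QS f /dhomogP fd; rewrite [f]mpolyE.
have : {subset msupp f <= msupp f} by []; move: {1 3}(msupp f) => s.
elim: s => [_|m s IH ms]; first by rewrite big_nil.
rewrite big_cons; apply: QS; first by apply: fd; rewrite ms ?mem_head.
by apply: IH => m' m's; rewrite ms // inE m's orbT.
Qed.

(** This is f(1, t, u), with t the inner and u the outer variable: the restriction to the generic
    line through (0 : 0 : 1). *)
Definition dehom (f : {mpoly F[3]}) : {poly {poly F}} :=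
  mmap (@polyC _ \o @polyC F) (pt 1 'X%:P 'X) f.

Lemma dehomX m : dehom 'X_[m] = ('X ^+ m i1)%:P * 'X ^+ m i2.
Proof.
by rewrite /dehom mmapX /mmap1 big_ord3 /pt /= expr1n mul1r polyC_exp.
Qed.

Lemma dehomP c f g : dehom (c *: f + g) = c%:P *: dehom f + dehom g.
Proof. by rewrite /dehom raddfD /= mmapZ /= mul_polyC. Qed.

Lemma dehomM f g : dehom (f * g) = dehom f * dehom g.
Proof. exact: rmorphM. Qed.

Lemma dehom0 : dehom 0 = 0.
Proof. exact: raddf0. Qed.

Lemma tdeg_leP d f : tdeg_le d f <-> forall k, (size (cf f k) <= d.+1 - k)%N.
Proof.
split=> H k; first have [->|/H] := eqVneq (cf f k) 0; rewrite ?size_poly0 //;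
  first by move: (size _) => s; lia.
by rewrite -size_poly_gt0; move: (size _) (H k) => s; lia.
Qed.

Lemma tdeg_le_dehom d f : f \is d.-homog -> tdeg_le d (dehom f).
Proof.
move=> fd; apply/tdeg_leP; elim/dhomog_ind: fd => [|c m g md IH] k.
  by rewrite dehom0 coef0 size_poly0.
rewrite dehomP coefD coefZ mul_polyC (leq_trans (size_polyD _ _)) // geq_max IH andbT.
rewrite (leq_trans (size_scale_leq _ _)) // dehomX coefCM coefXn.
have [->|] := eqVneq k (m i2); last by rewrite mulr0 size_poly0.
by rewrite mulr1 size_polyXn; move: md; rewrite mdegE big_ord3 /=; lia.
Qed.

Definition homogenize (d : nat) (f : {poly {poly F}}) : {mpoly F[3]} :=
  \sum_(i < d.+1) \sum_(j < d.+1 - i)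
    (cf f i)`_j *: 'X_[mexp (d - i - j) j i].

Lemma homogenizeP d c f g :
  homogenize d (c%:P *: f + g) = c *: homogenize d f + homogenize d g.
Proof.
rewrite /homogenize scaler_sumr -big_split; apply: eq_bigr => i _ /=.
rewrite scaler_sumr -big_split; apply: eq_bigr => j _ /=.
by rewrite coefD coefZ mul_polyC coefD coefZ scalerDl scalerA.
Qed.

Lemma homogenize_dhomog d f : homogenize d f \is d.-homog.
Proof.
apply: rpred_sum => i _; apply: rpred_sum => j _; apply: rpredZ.
by rewrite dhomogX /= mdeg_mexp; apply/eqP; have := ltn_ord i; have := ltn_ord j; lia.
Qed.

Lemma dehomK d f : f \is d.-homog -> homogenize d (dehom f) = f.
Proof.
elim/dhomog_ind => [|c m g md IH].
  rewrite dehom0 /homogenize big1 // => i _; rewrite big1 // => j _.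
  by rewrite !coef0 scale0r.
rewrite dehomP homogenizeP IH; congr (_ *: _ + _).
move: md; rewrite mdegE big_ord3 /= => md.
have m2d : (m i2 < d.+1)%N by lia.
have m1d : (m i1 < d.+1 - m i2)%N by lia.
rewrite /homogenize (bigD1 (Ordinal m2d)) //= [X in _ + X]big1 ?addr0 => [|i ii].
  rewrite (bigD1 (Ordinal m1d)) //= [X in _ + X]big1 ?addr0 => [|j jj].
    rewrite dehomX coefCM coefXn eqxx mulr1 coefXn eqxx scale1r.
    by congr 'X_[_]; rewrite [RHS]mexpE; congr mexp; lia.
  rewrite dehomX coefCM coefXn eqxx mulr1 coefXn.
  by rewrite -[_ == _]/(j == Ordinal m1d) (negbTE jj) scale0r.
rewrite big1 // => j _; rewrite dehomX coefCM coefXn.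
by rewrite -[_ == m i2]/(i == Ordinal m2d) (negbTE ii) mulr0 coef0 scale0r.
Qed.

Lemma homogenizeK d f : tdeg_le d f -> dehom (homogenize d f) = f.
Proof.
move=> /tdeg_leP fd.
have fE : f = \poly_(i < d.+1) \poly_(j < d.+1 - i) (cf f i)`_j.
  apply/polyP => i; rewrite coef_poly; case: ltnP => [_|di].
    apply/polyP => j; rewrite coef_poly; case: ltnP => // ij.
    by rewrite nth_default // (leq_trans (fd i)).
  by apply/eqP; rewrite -size_poly_leq0 (leq_trans (fd i)) //; lia.
rewrite [RHS]fE poly_def /homogenize /dehom raddf_sum; apply: eq_bigr => i _ /=.
rewrite raddf_sum poly_def -mul_polyC rmorph_sum mulr_suml; apply: eq_bigr => j _ /=.
rewrite mmapZ -/(dehom _) dehomX /= !mnmE /= -mul_polyC rmorphM /=.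
by rewrite mulrA.
Qed.

Lemma dehom_inj d f g : f \is d.-homog -> g \is d.-homog -> dehom f = dehom g -> f = g.
Proof. by move=> fd gd E; rewrite -(dehomK fd) E dehomK. Qed.

Lemma meval_affine f (a b : F) :
  f.@[pt 1 a b] = (map_poly (horner_eval a) (dehom f)).[b].
Proof.
elim/mpolyind: f => [|c m g _ _ IH].
  by rewrite meval0 dehom0 map_poly0 horner0.
rewrite mevalD mevalZ IH dehomP rmorphD hornerD -mul_polyC rmorphM hornerM.
rewrite /= map_polyC /= hornerC /horner_eval hornerC; congr (_ * _ + _).
rewrite -/(horner_eval a) dehomX mevalX big_ord3 /= rmorphM /= map_polyC map_polyXn /=.
by rewrite !hornerE /horner_eval hornerXn expr1n mul1r.
Qed.

(** At x0 = 0 only the terms of top total degree d in t and u survive, namely those at t^(d - i)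
    u^i. *)
Lemma meval_infinity d f (b : F) : f \is d.-homog ->
  f.@[pt 0 1 b] = (\poly_(i < d.+1) (cf (dehom f) i)`_(d - i)).[b].
Proof.
elim/dhomog_ind => [|c m g md IH].
  by rewrite meval0 dehom0 horner_poly big1 // => i _; rewrite !coef0 mul0r.
rewrite mevalD mevalZ {}IH dehomP !horner_poly.
under [in RHS]eq_bigr => i _.
  rewrite coefD coefZ mul_polyC coefD coefZ mulrDl -mulrA dehomX coefCM coefXn.
over.
rewrite big_split /= -mulr_sumr; congr (_ * _ + _).
move: md; rewrite mdegE mevalX !big_ord3 /= => md.
have m2d : (m i2 < d.+1)%N by lia.
rewrite expr1n mulr1 (bigD1 (Ordinal m2d)) //= big1 => [|i ii]; last first.
  by rewrite -[_ == m i2]/(i == Ordinal m2d) (negbTE ii) mulr0 coef0 mul0r.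
rewrite eqxx mulr1 addr0 coefXn expr0n; congr (_%:R * _).
by congr nat_of_bool; lia.
Qed.

(** The monomial x2^d alone contributes to u^d, and it alone is nonzero at (0 : 0 : 1). A form
    nonzero there thus has full degree in u and a constant leading coefficient, as Gauss's lemma
    requires. *)
Lemma meval_vertical d f : f \is d.-homog ->
  (dehom f)`_d = (f.@[pt 0 0 1])%:P.
Proof.
elim/dhomog_ind => [|c m g md IH]; first by rewrite dehom0 coef0 meval0.
rewrite dehomP coefD coefZ {}IH mevalD mevalZ rmorphD rmorphM /=; congr (_ * _ + _).
move: md; rewrite mdegE mevalX !big_ord3 /= => md.
rewrite dehomX coefCM coefXn expr1n mulr1 -exprD expr0n.
have [d2|d2] := eqVneq d (m i2).
  have [-> ->] : (m i0 = 0 /\ m i1 = 0)%N by lia.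
  by rewrite mulr1.
by rewrite mulr0 (_ : _ == _ = false) //; lia.
Qed.

End Forms.

Section SizeDehom.
Local Open Scope ring_scope.
Variables (F : fieldType) (d : nat) (f : {mpoly F[3]}).
Hypothesis fd : f \is d.-homog.

Lemma size_dehom_le : (size (dehom f) <= d.+1)%N.
Proof.
have /tdeg_leP fk := tdeg_le_dehom fd.
apply/leq_sizeP => k dk; apply/eqP; rewrite -size_poly_leq0.
by apply: leq_trans (fk k) _; move: dk; clear; lia.
Qed.

Hypothesis f_vertical : f.@[pt 0 0 1] != 0.

Lemma size_dehom_vertical : size (dehom f) = d.+1.
Proof.
apply/eqP; rewrite eqn_leq size_dehom_le /= ltnNge;
  apply/negP => /leq_sizeP/(_ d (leqnn d)).
by rewrite (meval_vertical fd) => /eqP; rewrite polyC_eq0 (negbTE f_vertical).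
Qed.

Lemma lead_coef_dehom_vertical : lead_coef (dehom f) = (f.@[pt 0 0 1])%:P.
Proof. by rewrite lead_coefE size_dehom_vertical (meval_vertical fd). Qed.
End SizeDehom.

Lemma dim_forms (F : fieldType) (d : nat) : \dim {: dhomog 3 F d} = 'C(d.+2, 2).
Proof.
rewrite dimvf; transitivity 'C(d + 2, d); first by [].
by rewrite -bin_sub ?leq_addr // addKn addn2.
Qed.

(** * Points of the projective plane *)

Section Points.
Local Open Scope ring_scope.
Variable F : finFieldType.
Local Notation i0 := (ord0 : 'I_3).
Local Notation i1 := (lift ord0 ord0 : 'I_3).
Local Notation i2 := (lift ord0 (lift ord0 ord0) : 'I_3).
Local Notation q := #|F|.

Definition ptrow (a b c : F) : 'rV[F]_3 := \row_i pt a b c i.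

Arguments ptrow (a b c)%_ring_scope.

(* The first nonzero coordinate; each point of the plane has a unique
   representative v with lead v = 1. *)
Definition lead (v : 'rV[F]_3) : F :=
  if v 0 i0 != 0 then v 0 i0 else if v 0 i1 != 0 then v 0 i1 else v 0 i2.

Lemma leadZ c v : c != 0 -> lead (c *: v) = c * lead v.
Proof.
move=> c0; rewrite /lead !mxE !mulf_eq0 (negbTE c0) /=.
by case: (v 0 i0 == 0); case: (v 0 i1 == 0).
Qed.

Lemma lead_eq0 v : (lead v == 0) = (v == 0).
Proof.
apply/eqP/eqP => [|->]; last by rewrite /lead !mxE eqxx.
rewrite /lead; case: eqVneq => [v0|/eqP//]; case: eqVneq => [v1 v2|/eqP//].
by apply/rowP; apply: ord3P; rewrite mxE.
Qed.

Lemma lead1_neq0 v : lead v == 1 -> v != 0.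
Proof. by rewrite -lead_eq0 => /eqP->; rewrite oner_neq0. Qed.

Lemma ptrowE a b c : (ptrow a b c) 0 =1 pt a b c.
Proof. by move=> i; rewrite mxE. Qed.

Lemma card_points (Q : pred 'rV[F]_3) :
  #|[set v | (lead v == 1) && Q v]| =
  (\sum_(a : F) \sum_(b : F) Q (ptrow 1 a b) + \sum_(b : F) Q (ptrow 0 1 b) +
   Q (ptrow 0%R 0%R 1%R))%N.
Proof.
pose nu (t : (F * F) + (F + unit)) : 'rV_3 :=
  match t with
  | inl u => ptrow 1 u.1 u.2 | inr (inl b) => ptrow 0 1 b | inr (inr _) => ptrow 0 0 1
  end.
pose dec (v : 'rV[F]_3) : (F * F) + (F + unit) :=
  if v 0 i0 != 0 then inl (v 0 i1, v 0 i2) else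
  if v 0 i1 != 0 then inr (inl (v 0 i2)) else inr (inr tt).
have nuK : cancel nu dec.
  by move=> [[a b]|[b|[]]]; rewrite /dec /nu !mxE /pt /= ?oner_neq0 ?eqxx.
have nu_lead t : lead (nu t) = 1.
  by case: t => [[a b]|[b|[]]];
    rewrite /lead /nu !mxE /pt /= ?oner_neq0 ?eqxx /= ?oner_neq0.
have decK v : lead v == 1 -> nu (dec v) = v.
  rewrite /lead /dec => lv; apply/rowP; move: lv;
    case: (eqVneq (v 0 i0) 0) => v0 /=; last first.
    by move=> /eqP v01; apply: ord3P; rewrite /nu !mxE.
  by case: (eqVneq (v 0 i1) 0) => v1 /= /eqP v2; apply: ord3P; rewrite /nu !mxE.
transitivity #|[set nu t | t in [pred t | Q (nu t)]]|.
  apply: eq_card => v; rewrite inE; apply/andP/imsetP => [[lv Qv]|[t Qt ->]].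
    by exists (dec v); rewrite ?inE decK.
  by rewrite nu_lead eqxx; move: Qt; rewrite inE.
rewrite card_imset; last exact: can_inj nuK.
rewrite -sum1_card big_mkcond big_sumType /= big_sumType /= addnA.
congr (_ + _ + _)%N; last by rewrite (big_pred1 tt) => [|[]//]; rewrite inE /nu;
  case: (Q _).
  rewrite pair_bigA; apply: eq_bigr => -[a b] _; rewrite inE /nu /=; by case: (Q _).
Qed.

Lemma card_norm_points : #|[set v | lead v == 1]| = (q ^ 2 + q + 1)%N.
Proof.
have := card_points xpredT; rewrite (eq_card (B := [set v | lead v == 1])) => [->|v].
  by rewrite !sum_nat_const !muln1 -mulnn.
by rewrite !inE andbT.
Qed.

Lemma card_cone (Q : pred 'rV[F]_3) :
  (forall c v, c != 0 -> Q (c *: v) = Q v) ->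
  #|[set v | (v != 0) && Q v]| = ((q - 1) * #|[set v | (lead v == 1%R) && Q v]|)%N.
Proof.
move=> QZ; have -> : (q - 1)%N = #|[set c : F | c != 0]|.
  by rewrite cardsE (cardC1 (0 : F)) subn1.
rewrite -cardsX.
rewrite -(card_in_imset (f := fun u : F * 'rV[F]_3 => u.1 *: u.2)).
  apply: eq_card => v; apply/idP/imsetP => [|[[c w]]].
    rewrite inE => /andP[v0 Qv]; have lv : lead v != 0 by rewrite lead_eq0.
    exists (lead v, (lead v)^-1 *: v); last by rewrite /= scalerA mulfV ?scale1r.
    by rewrite !inE /= lv leadZ ?invr_neq0 // mulVf ?eqxx // QZ ?invr_neq0.
  rewrite !inE /= => /and3P[c0 lw Qw] ->.
  by rewrite scaler_eq0 negb_or c0 lead1_neq0 // QZ.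
move=> [c w] [c' w'];
  rewrite !inE /= => /and3P[c0 /eqP lw _] /and3P[c'0 /eqP lw' _] E.
have := congr1 lead E; rewrite !leadZ // lw lw' !mulr1 => cE.
by move: E; rewrite cE => /scalerI->.
Qed.

(** An invertible matrix permutes the nonzero vectors but not the normalized ones, so both sides are
    compared through [card_cone]. *)
Lemma card_points_unit (M : 'M[F]_3) (Q : pred 'rV[F]_3) :
  M \in unitmx -> (forall c v, c != 0 -> Q (c *: v) = Q v) ->
  #|[set v | (lead v == 1) && Q (v *m M)]| = #|[set v | (lead v == 1) && Q v]|.
Proof.
move=> Mu QZ.
have q1 : (0 < q - 1)%N by rewrite subn_gt0 finNzRing_gt1.
apply/eqP; rewrite -(eqn_pmul2l q1) -!card_cone // => [|c v c0]; last first.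
  by rewrite -scalemxAl QZ.
rewrite -(card_imset (f := mulmx^~ M)); last exact: can_inj (mulmxK Mu).
apply/eqP/eq_card => v; rewrite inE; apply/imsetP/andP => [[w]|[v0 Qv]].
  rewrite inE => /andP[w0 Qw] ->; split=> //.
  by apply: contraNneq w0 => /(congr1 (mulmx^~ (invmx M)));
    rewrite mulmxK // mul0mx => ->.
exists (v *m invmx M); last by rewrite mulmxKV.
rewrite inE mulmxKV // Qv andbT; apply: contraNneq v0 => /(congr1 (mulmx^~ M)).
by rewrite mulmxKV // mul0mx => ->.
Qed.

Lemma move_point (u v : 'rV[F]_3) : u != 0 -> v != 0 ->
  exists2 M : 'M[F]_3, M \in unitmx & u *m M = v.
Proof.
(* A nonzero row has rank one, and its rank decomposition writes it as a multiple of the first unit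
   row times an invertible matrix. *)
have scal (w : 'rV[F]_3) : w != 0 -> exists2 a : F, a != 0 &
    exists2 R : 'M[F]_3, R \in unitmx & w = a *: (pid_mx 1 *m R).
  move=> w0; have cu := col_ebase_unit w; have wE := mulmx_ebase w.
  rewrite rank_rV w0 in wE.
  exists (col_ebase w 0 0).
    by move: cu;
      rewrite [col_ebase w]mx11_scalar unitmxE det_scalar1 unitfE mxE mulr1n.
  exists (row_ebase w); first exact: row_ebase_unit.
  by rewrite -{1}wE {1}[col_ebase w]mx11_scalar mul_scalar_mx -scalemxAl.
move=> /scal[a a0 [R Ru ->]] /scal[b b0 [S Su ->]].
exists ((b / a) *: (invmx R *m S)).
  by rewrite unitmxZ ?unitfE ?mulf_neq0 ?invr_neq0 // unitmx_mul unitmx_inv Ru.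
rewrite -scalemxAl -scalemxAr scalerA mulrC divfK // -mulmxA mulmxA mulmxA.
by rewrite mulmxK.
Qed.

Lemma mevalZ_dhomog n d (f : {mpoly F[n]}) (c : F) (v : 'rV[F]_n) :
  f \is d.-homog -> f.@[(c *: v) 0] = c ^+ d * f.@[v 0].
Proof.
elim/dhomog_ind => [|a m g md IH]; first by rewrite !meval0 mulr0.
rewrite !mevalD !mevalZ IH mulrDr mulrCA; congr (_ * _ + _).
rewrite !mevalX -md mdegE -prodrXr -big_split; apply: eq_bigr => i _ /=.
by rewrite mxE exprMn.
Qed.

Definition subst_tuple n (M : 'M[F]_n) : n.-tuple {mpoly F[n]} :=
  [tuple \sum_j M j i *: 'X_j | i < n].

Definition subst n (M : 'M[F]_n) (f : {mpoly F[n]}) := f \mPo subst_tuple M.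

Lemma meval_subst n (M : 'M[F]_n) f (v : 'rV[F]_n) :
  (subst M f).@[v 0] = f.@[(v *m M) 0].
Proof.
rewrite comp_mpoly_meval; apply: meval_eq => i.
rewrite tnth_mktuple raddf_sum mxE; apply: eq_bigr => j _ /=.
by rewrite mevalZ mevalXU mulrC.
Qed.

Lemma subst_dhomog n (M : 'M[F]_n) d f : f \is d.-homog -> subst M f \is d.-homog.
Proof.
elim/dhomog_ind => [|c m g md IH]; first by rewrite /subst raddf0 dhomog0.
rewrite /subst raddfD /= comp_mpolyZ rpredD // rpredZ //.
rewrite comp_mpolyX -md mdegE.
apply: (big_ind2 (fun (p : {mpoly F[n]}) k => p \is k.-homog)) => [|p k p' k' pk pk'|i _].
- exact: dhomog1.
- exact: dhomogM.
suff t1 : tnth (subst_tuple M) i \is 1.-homog.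
  by have := dhomogMn (m i) t1; rewrite mul1n.
by rewrite tnth_mktuple; apply: rpred_sum => j _; rewrite rpredZ // dhomogX /= mdeg1.
Qed.

Lemma substK n (M : 'M[F]_n) f : M \in unitmx -> subst (invmx M) (subst M f) = f.
Proof.
move=> Mu; elim/mpolyind: f => [|c m g _ _ IH]; first by rewrite /subst !raddf0.
rewrite /subst !raddfD /= !comp_mpolyZ -!/(subst _ _) IH; congr (_ *: _ + _).
rewrite /subst comp_mpolyX rmorph_prod mpolyXE_id; apply: eq_bigr => i _ /=.
rewrite rmorphXn; congr (_ ^+ _); rewrite tnth_mktuple raddf_sum /=.
under eq_bigr => j _ do rewrite comp_mpolyZ comp_mpolyXU -tnth_nth tnth_mktuple scaler_sumr.
rewrite exchange_big /= (bigD1 i) //= [X in _ + X]big1 ?addr0 => [|k ki].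
  under eq_bigr => j _ do rewrite scalerA.
  rewrite -scaler_suml; have := mulVmx Mu => /matrixP/(_ i i); rewrite !mxE eqxx.
  by under eq_bigr => j _ do rewrite mulrC; move=> ->; rewrite scale1r.
under eq_bigr => j _ do rewrite scalerA.
rewrite -scaler_suml; have := mulVmx Mu => /matrixP/(_ k i); rewrite !mxE (negbTE ki).
by under eq_bigr => j _ do rewrite mulrC; move=> ->; rewrite scale0r.
Qed.

End Points.

Arguments ptrow {F} (a b c)%_ring_scope.

(** * Serre's bound on the zeros of a form *)

Section Serre.
Local Open Scope ring_scope.
Variable F : finFieldType.
Local Notation q := #|F|.

Lemma sum_roots_le (p : {poly F}) : p != 0 ->
  (\sum_(b : F) (p.[b] == 0%R) <= (size p).-1)%N.
Proof.
move=> p0; rewrite -big_mkcond sum1_card /= cardE -ltnS.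
rewrite [X in (_ < X)%N](_ : _ = size p); last by rewrite -(polySpred p0).
apply: max_poly_roots => //; last exact: enum_uniq.
by apply/allP => b; rewrite mem_enum.
Qed.

Lemma sum_bool_le (Q : pred F) : (\sum_(b : F) Q b <= q)%N.
Proof. by rewrite -[q]mul1n mulnC -sum_nat_const leq_sum // => b _; case: (Q b). Qed.

Lemma form_zeros_vertical (f : {mpoly F[3]}) (e : nat) :
  f \is e.-homog -> f != 0 -> (0 < e <= q)%N -> f.@[pt 0 0 1] = 0 ->
  (#|[set v : 'rV[F]_3 | (lead v == 1%R) && (f.@[v 0%R] == 0%R)]| <= e * q + 1)%N.
Proof.
move=> fe f0 /andP[e0 eq] fP; rewrite (card_points (fun v => f.@[v 0%R] == 0)).
have evE a b c : f.@[(ptrow a b c) 0] = f.@[pt a b c].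
  by apply: meval_eq; apply: ptrowE.
pose D := dehom f; have D0 : D != 0.
  by apply: contraNneq f0 => D0;
    rewrite -(dehomK fe) -/D D0 -(dehom0 F) dehomK // dhomog0.
have /tdeg_leP De := tdeg_le_dehom fe.
have sD : (size D <= e)%N.
  apply/leq_sizeP => j; rewrite leq_eqVlt => /orP[/eqP<-|ej].
    by rewrite (meval_vertical fe) fP.
  by apply/eqP; rewrite -size_poly_leq0 (leq_trans (De j)) //; lia.
(* e - nu is the multiplicity of (0 : 0 : 1), and the roots of L give the lines
   through this point on which f vanishes. *)
pose L := lead_coef D; have L0 : L != 0 by rewrite lead_coef_eq0.
pose nu := (size D).-1; have sDE : size D = nu.+1 by rewrite (polySpred D0).
have sL : (size L <= e.+1 - nu)%N by exact: De.
pose k := (\sum_(a : F) (L.[a] == 0%R))%N.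
have kL : (k <= (size L).-1)%N := sum_roots_le L0.
(* Apart from (0 : 0 : 1), the line x1 = a x0 has at most q zeros if L vanishes at a, and at most nu
   otherwise. *)
have aff : (\sum_a \sum_b (f.@[(ptrow 1 a b) 0%R] == 0%R) <= k * q + (q - k) * nu)%N.
  rewrite (_ : (_ + _)%N = (\sum_(a : F) if L.[a] == 0%R then q else nu)%N);
    last first.
    have kq : (k <= q)%N := sum_bool_le _.
    apply/eqP; rewrite -(eqn_add2r (k * nu)) -addnA -mulnDl subnK //; apply/eqP.
    have kM m : (k * m = \sum_a (L.[a] == 0%R) * m)%N by rewrite big_distrl.
    rewrite !kM -big_split /=.
    have <- : (\sum_(a : F) nu = q * nu)%N by rewrite sum_nat_const.
    rewrite -big_split; apply: eq_bigr => a _.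
    by case: ifP; rewrite ?mul1n ?mul0n ?addn0.
  apply: leq_sum => a _; case: ifP => La; first exact: sum_bool_le.
  pose p := map_poly (horner_eval a) D.
  have pc : p`_nu = L.[a] by rewrite coef_map /= /horner_eval /L lead_coefE.
  have p0 : p != 0 by apply: contraFneq La => p0; rewrite -pc p0 coef0.
  under eq_bigr => b _ do rewrite evE meval_affine -/D -/p.
  apply: leq_trans (sum_roots_le p0) _; rewrite -ltnS -(polySpred p0) -sDE.
  exact: size_poly.
pose t := (\sum_b (f.@[(ptrow 0 1 b) 0%R] == 0%R))%N.
have tq : (t <= q)%N := sum_bool_le _.
(* If L has its full degree e - nu, then f does not vanish identically on the line x0 = 0, where its
   degree in x2 is again nu. *)
have tnu : (size L = e.+1 - nu)%N -> (t <= nu)%N.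
  move=> sLE; pose p := \poly_(i < e.+1) D`_i`_(e - i).
  have pc : p`_nu = lead_coef L.
    rewrite coef_poly ltnW ?ltnS -?sDE // /L lead_coefE [in RHS]lead_coefE sLE.
    by rewrite subSn // ltnW // -sDE.
  have p0 : p != 0 by apply: contraNneq L0 => p0; rewrite -lead_coef_eq0 -pc p0 coef0.
  rewrite /t; under eq_bigr => b _ do rewrite evE (meval_infinity b fe) -/D -/p.
  apply: leq_trans (sum_roots_le p0) _; rewrite -ltnS -(polySpred p0) -sDE.
  apply/leq_sizeP => j jD; rewrite coef_poly; case: ifP => // _.
  by rewrite [D`_j]nth_default // coef0.
rewrite evE fP eqxx leq_add2r.
apply: leq_trans (leq_add aff (leqnn t)) _.
have kq : (k <= q)%N := sum_bool_le _.
have Lp : (0 < size L)%N by rewrite size_poly_gt0.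
rewrite sDE in sD; move: sL kL tnu tq kq Lp sD.
move: (size L) (k) (nu) (t) => l k' nu' t'; clear -eq.
(* Either L has full degree, with k <= e - nu and t <= nu, or k <= e - nu - 1, which makes room for
   a whole line x0 = 0 of zeros. *)
rewrite leq_eqVlt => /orP[/eqP-> kl /(_ erefl) tn tq kq _ ne | lt kl _ tq kq _ ne].
  have k1 : (k' <= e - nu')%N by lia.
  clear -k1 tn ne eq kq; nia.
have k1 : (k' <= e - nu' - 1)%N by lia.
clear -k1 tq ne eq kq lt; nia.
Qed.

End Serre.

(** * Zero loci and changes of coordinates *)

Section ZeroLocus.
Local Open Scope ring_scope.
Variable F : finFieldType.
Local Notation q := #|F|.

Lemma ptrow001_neq0 : ptrow 0 0 1 != 0 :> 'rV[F]_3.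
Proof.
apply/eqP => /rowP/(_ (lift ord0 (lift ord0 ord0)))/eqP.
by rewrite !mxE oner_eq0.
Qed.

(** If there is a zero at all, a change of coordinates moves it to (0 : 0 : 1). *)
Lemma form_zeros_le (f : {mpoly F[3]}) (e : nat) :
  f \is e.-homog -> f != 0 -> (0 < e <= q)%N ->
  (#|[set v : 'rV[F]_3 | (lead v == 1%R) && (f.@[v 0%R] == 0%R)]| <= e * q + 1)%N.
Proof.
move=> fe f0 eq; set Z := [set v | _].
have [->|/set0Pn[P]] := eqVneq Z set0; first by rewrite cards0.
rewrite inE => /andP[/lead1_neq0 P0 /eqP fP].
have [M Mu MP] := move_point ptrow001_neq0 P0.
have fZ c (v : 'rV_3) : c != 0 -> (f.@[(c *: v) 0] == 0) = (f.@[v 0] == 0).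
  by move=> c0; rewrite (mevalZ_dhomog _ _ fe) mulf_eq0 expf_eq0 (negbTE c0) andbF.
rewrite /Z -(card_points_unit (Q := fun v => f.@[v 0] == 0) Mu fZ).
under eq_finset => v do rewrite -meval_subst.
apply: form_zeros_vertical => //; first exact: subst_dhomog.
  by apply: contraNneq f0 => sf0; rewrite -(substK f Mu) sf0 /subst raddf0.
transitivity (subst M f).@[(ptrow 0 0 1) 0]; last by rewrite meval_subst MP.
by apply: meval_eq => i; rewrite ptrowE.
Qed.

Variable d : nat.
Local Notation forms := (dhomog 3 F d).
Implicit Types (W : {vspace forms}) (v : 'rV[F]_3).

Definition vanish W v :=
  [forall f : finvect_type forms, (f \in W) ==> ((mpoly_of_dhomog f).@[v 0] == 0)].

Lemma vanishP W v :
  reflect (forall f : forms, f \in W -> (mpoly_of_dhomog f).@[v 0] = 0) (vanish W v).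
Proof.
apply: (iffP forallP) => H f; last by apply/implyP => /H->.
by move=> fW; have /implyP/(_ fW)/eqP := H f.
Qed.

Definition norm_zeros W := [set v | (lead v == 1) && vanish W v].

Lemma meval_formZ (f : forms) c v :
  (mpoly_of_dhomog f).@[(c *: v) 0] = c ^+ d * (mpoly_of_dhomog f).@[v 0].
Proof. exact: mevalZ_dhomog (dhomog_is_dhomog f). Qed.

Lemma vanishZ W c v : c != 0 -> vanish W (c *: v) = vanish W v.
Proof.
move=> c0; apply/vanishP/vanishP => H f /H; last first.
  by rewrite meval_formZ => ->; rewrite mulr0.
by move/eqP; rewrite meval_formZ mulf_eq0 expf_eq0 (negbTE c0) andbF => /eqP.
Qed.

Lemma card_zero_locus W : #|zero_locus W| = #|norm_zeros W|.
Proof.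
rewrite -(card_in_imset (f := fun v : 'rV[F]_3 => <[v]>%VS)).
  apply: eq_card => L; apply/idP/imsetP => [|[v]].
    rewrite !inE => /andP[/eqP dL /forallP LW].
    pose w := vpick L; have w0 : w != 0 by rewrite vpick0 -dimv_eq0 dL.
    have LE : L = <[w]>%VS.
      apply/esym/eqP; rewrite eqEdim -memvE memv_pick dim_vline w0 dL //.
    have lw : lead w != 0 by rewrite lead_eq0.
    exists ((lead w)^-1 *: w).
      rewrite inE leadZ ?invr_eq0 // mulVf // eqxx /= vanishZ ?invr_eq0 //.
      apply/vanishP => f fW; have /implyP/(_ fW)/forallP/(_ w) := LW f.
      by rewrite memv_pick => /eqP.
    rewrite LE; apply/eqP; rewrite eqEsubv -!memvE memvZ ?memv_line // andbT.
    by apply/vlineP; exists (lead w); rewrite scalerA mulfV ?scale1r.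
  rewrite inE => /andP[lv /vanishP vW] ->; rewrite !inE dim_vline lead1_neq0 //=.
  apply/forallP => f; apply/implyP => fW; apply/forallP => w; apply/implyP.
  by move=> /vlineP[c ->]; rewrite meval_formZ (vW f fW) mulr0.
move=> v w; rewrite !inE => /andP[/eqP lv _] /andP[/eqP lw _] E.
have : v \in <[w]>%VS by rewrite -E memv_line.
move=> /vlineP[c vE]; have c0 : c != 0.
  by apply: contraNneq (lead1_neq0 (introT eqP lv)) => c0; rewrite vE c0 scale0r.
by move: lv; rewrite vE leadZ // lw mulr1 => ->; rewrite scale1r.
Qed.

Definition form_subst (M : 'M[F]_3) (f : forms) : forms :=
  DHomog (subst_dhomog M (dhomog_is_dhomog f)).

Lemma form_subst_linear M : linear (form_subst M).
Proof.
by move=> c f g; apply: val_inj; rewrite /= /subst linearP.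
Qed.

HB.instance Definition _ M :=
  GRing.isLinear.Build F forms forms _ (form_subst M) (form_subst_linear M).

Definition vsubst M W := (linfun (form_subst M) @: W)%VS.

Lemma dim_vsubst M W : M \in unitmx -> \dim (vsubst M W) = \dim W.
Proof.
move=> Mu; apply: limg_dim_eq; apply/eqP; rewrite -subv0; apply/subvP => f.
rewrite memv_cap memv_ker lfunE memv0 => /andP[_ /eqP /(congr1 (@mpoly_of_dhomog _ _ _))].
rewrite /= => sf0; apply/eqP/val_inj; rewrite /= -(substK (mpoly_of_dhomog f) Mu) sf0.
by rewrite /subst raddf0.
Qed.

Lemma vanish_vsubst M W v : vanish (vsubst M W) v = vanish W (v *m M).
Proof.
apply/vanishP/vanishP => H f.
  move=> fW; rewrite -meval_subst; apply: (H (form_subst M f)).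
  by rewrite -(lfunE (form_subst M)) memv_img.
by move=> /memv_imgP[g gW ->]; rewrite lfunE /= meval_subst H.
Qed.

Lemma card_norm_zeros_vsubst M W : M \in unitmx ->
  #|norm_zeros (vsubst M W)| = #|norm_zeros W|.
Proof.
move=> Mu; rewrite /norm_zeros; under eq_finset => v do rewrite vanish_vsubst.
by apply: card_points_unit => // c v; apply: vanishZ.
Qed.

End ZeroLocus.

(** * The upper bound *)

Section EvalMonomials.
Local Open Scope ring_scope.
Variables (K : fieldType) (n : nat) (x z : 'I_n -> K) (t : K).
Local Notation E := (eval_space x z).

Lemma eval_space_mulx k (v : 'rV[K]_n) (y : 'I_n -> K) :
  (v <= E k)%MS -> (forall i, y i = v 0 i * x i) -> (\row_i y i <= E k.+1)%MS.
Proof.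
move=> vE yE; apply: submx_trans (eval_space_Dx x z k).
suff -> : \row_i y i = v *m diag_mx (\row_i x i) by exact: submxMr.
by apply/rowP => i; rewrite mul_mx_diag !mxE yE.
Qed.

Lemma eval_space_mulz k (v : 'rV[K]_n) (y : 'I_n -> K) :
  (v <= E k)%MS -> (forall i, y i = v 0 i * z i) -> (\row_i y i <= E k.+1)%MS.
Proof.
move=> vE yE; apply: submx_trans (eval_space_Dz x z k).
suff -> : \row_i y i = v *m diag_mx (\row_i z i) by exact: submxMr.
by apply/rowP => i; rewrite mul_mx_diag !mxE yE.
Qed.

(** With the line x1 = t x0 at infinity, x0, x1 and x2 become x, 1 + t x and z, so this row holds
    the values of the monomial with exponents a, b, c. *)
Lemma eval_space_monomial a b c :
  ((\row_i (x i ^+ a * (1 + t * x i) ^+ b * z i ^+ c))%R <= E (a + b + c).+1)%MS.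
Proof.
elim: c => [|c IH]; last first.
  by rewrite addnS; apply: eval_space_mulz IH _ => i; rewrite mxE exprSr; ring.
rewrite addn0; elim: b => [|b IH]; last first.
  rewrite addnS; set r := (\row_i _) in IH.
  have -> : \row_i (x i ^+ a * (1 + t * x i) ^+ b.+1 * z i ^+ 0) =
     r + t *: \row_i (r 0 i * x i).
    by apply/rowP => i; rewrite !mxE exprSr; ring.
  apply: addmx_sub; first exact: submx_trans IH (eval_spaceS _ _ _).
  by apply: scalemx_sub; apply: eval_space_mulx IH _.
rewrite addn0; elim: a => [|a IH]; last first.
  by apply: eval_space_mulx IH _ => i; rewrite mxE exprSr; ring.
have -> : \row_i (x i ^+ 0 * (1 + t * x i) ^+ 0 * z i ^+ 0) = row 0 (top_eval x z 0).
  by apply/rowP => i; rewrite !mxE /= subnn !expr0 mulr1.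
exact: submx_trans (row_sub _ _) (addsmxSr _ _).
Qed.

(** Replacing 1 + t x by t x keeps only the leading form, so the difference has degree less than a +
    b + c. *)
Lemma eval_space_monomial_sub a b c :
  ((\row_i (x i ^+ a * ((1 + t * x i) ^+ b - (t * x i) ^+ b) * z i ^+ c))%R
     <= E (a + b + c))%MS.
Proof.
elim: b => [|b IH].
  suff -> : \row_i (x i ^+ a * ((1 + t * x i) ^+ 0 - (t * x i) ^+ 0) * z i ^+ c) = 0.
    exact: sub0mx.
  by apply/rowP => i; rewrite !mxE !expr0 subrr mulr0 mul0r.
rewrite addnS addSn; set r := (\row_i _) in IH; set s := \row_i _.
have -> : s = \row_i (x i ^+ a * (1 + t * x i) ^+ b * z i ^+ c) +
    t *: \row_i (r 0 i * x i).
  by apply/rowP => i; rewrite !mxE !exprSr; ring.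
apply: addmx_sub; first exact: eval_space_monomial.
by apply: scalemx_sub; apply: eval_space_mulx IH _.
Qed.
End EvalMonomials.

Lemma scalerB_addrACA (R : nzRingType) (V : lmodType R) (c : R) (u v w y : V) :
  (c *: u + v - (c *: w + y) = c *: (u - w) + (v - y))%R.
Proof. by rewrite scalerBr opprD addrACA. Qed.

(** * Common zeros of a space of forms without common factor *)

Section CoprimeZeros.
Local Open Scope ring_scope.
Variables (F : finFieldType) (d : nat) (W : {vspace dhomog 3 F d}).
Variables (K : fieldType) (tofrac : {rmorphism {poly F} -> K}).
Hypothesis tofrac_inj : injective tofrac.
Local Notation iota := (map_poly tofrac).
Local Notation cst c := (tofrac (c : F)%:P).
Local Notation i0 := (ord0 : 'I_3).
Local Notation i1 := (lift ord0 ord0 : 'I_3).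
Local Notation i2 := (lift ord0 (lift ord0 ord0) : 'I_3).
Local Notation n := #|norm_zeros W|.
Local Notation tau := (tofrac 'X).

Hypothesis W_vertical :
  exists2 h : dhomog 3 F d, h \in W & (mpoly_of_dhomog h).@[pt 0 0 1] != 0.
Hypothesis W_gcd : forall g : {poly K},
  (forall h : dhomog 3 F d, h \in W -> g %| iota (dehom h)) -> (size g <= 1)%N.

Let p (i : 'I_n) : 'rV[F]_3 := enum_val i.

Let p_lead i : lead (p i) = 1.
Proof. by have := enum_valP i; rewrite inE => /andP[/eqP]. Qed.

Let p_vanish i (h : dhomog 3 F d) : h \in W -> (mpoly_of_dhomog h).@[p i 0] = 0.
Proof. by have := enum_valP i; rewrite inE => /andP[_ /vanishP H] /H. Qed.

(** Some member of W is nonzero at (0 : 0 : 1), so no common zero lies there; hence [ell] vanishes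
    at none of them. *)
Let p_vertical i : ~~ ((p i 0 i0 == 0) && (p i 0 i1 == 0)).
Proof.
apply/negP => /andP[/eqP p0 /eqP p1]; have [h hW] := W_vertical.
suff -> : (mpoly_of_dhomog h).@[pt 0 0 1] = (mpoly_of_dhomog h).@[p i 0].
  by rewrite p_vanish ?eqxx.
apply: meval_eq; apply: ord3P; rewrite ?p0 ?p1 //=.
by have := p_lead i; rewrite /lead p0 p1 eqxx.
Qed.

(* The affine coordinates x = x0 / ell, z = x2 / ell put the generic line
   ell = x1 - t x0 through (0 : 0 : 1) at infinity. *)
Let ell i : K := cst (p i 0 i1) - tau * cst (p i 0 i0).
Let x i : K := cst (p i 0 i0) / ell i.
Let z i : K := cst (p i 0 i2) / ell i.

Let cross (a b c a' b' c' : F) :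
  cst a * (cst b - tau * cst c) = cst a' * (cst b' - tau * cst c') ->
  a * b = a' * b' /\ a * c = a' * c'.
Proof.
rewrite -!rmorphM -!rmorphB -!rmorphM => /tofrac_inj E.
have := congr1 (fun u : {poly F} => u`_0) E;
  have := congr1 (fun u : {poly F} => u`_1) E.
rewrite !coefCM !coefB !coefMC !coefC !coefX /= !sub0r !mul1r !mul0r !subr0 !mulrN.
by move=> /oppr_inj E1 E0; split.
Qed.

Let ell_neq0 i : ell i != 0.
Proof.
apply/eqP => li0; have [|p1 p0] := @cross 1 (p i 0 i1) (p i 0 i0) 0 0 0.
  by rewrite -/(ell i) li0 mulr0 rmorph0 mul0r.
by have := p_vertical i; rewrite -[p i 0 i0]mul1r -[p i 0 i1]mul1r p0 p1 !mul0r eqxx.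
Qed.

(** Cross-multiplying and comparing the coefficients at 1 and t gives equations over F that make the
    two normalized vectors proportional, hence equal. *)
Let xz_inj i j : x i = x j -> z i = z j -> i = j.
Proof.
move=> /eqP; rewrite eqr_div // => /eqP/cross[E01 _].
move=> /eqP; rewrite eqr_div // => /eqP/cross[E21 E20].
apply: enum_val_inj; rewrite -/(p i) -/(p j).
have := p_lead i; have := p_lead j; have := p_vertical i; have := p_vertical j.
rewrite /lead; move: E01 E21 E20.
have rowE (u v : 'rV[F]_3) :
    u 0 i0 = v 0 i0 -> u 0 i1 = v 0 i1 -> u 0 i2 = v 0 i2 -> u = v.
  by move=> e0 e1 e2; apply/rowP; apply: ord3P.
have [pi0|pi0] := eqVneq (p i 0 i0) 0; have [pj0|pj0] := eqVneq (p j 0 i0) 0 => /=.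
- move=> _ E21 _ vj vi; rewrite vi vj => pj1 pi1.
  by apply: rowE; rewrite ?pi0 ?pj0 ?pi1 ?pj1 //; move: E21; rewrite pi1 pj1 !mulr1.
- rewrite pi0 mul0r => /esym/eqP; rewrite mulf_eq0 (negbTE pj0) /= => pi1 _ _ _.
  by rewrite pi1.
- rewrite pj0 mul0r => /eqP; rewrite mulf_eq0 (negbTE pi0) /= => pj1 _ _.
  by rewrite pj1.
move=> E01 _ E20 _ _ pj0' pi0'; move: E01 E20;
  rewrite pi0' pj0' !mul1r !mulr1 => E1 E2.
by apply: rowE; rewrite ?pi0' ?pj0'.
Qed.

Let evr (f : {mpoly F[3]}) : 'rV[K]_n := \row_i (cst f.@[p i 0] / ell i ^+ d).

Let evrP c f g : evr (c *: f + g) = cst c *: evr f + evr g.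
Proof.
by apply/rowP => i; rewrite !mxE mevalD mevalZ rmorphD rmorphD rmorphM rmorphM /=;
  ring.
Qed.

(** As a polynomial in x and z, f / ell^d has the leading form f(x, t x, z), whose coefficients are
    those of the restriction of f to the generic line. *)
Let top_eval_dehom (f : {mpoly F[3]}) : f \is d.-homog ->
  (poly_rV (iota (dehom f)) *m top_eval x z d - evr f <= eval_space x z d)%MS.
Proof.
elim/dhomog_ind => [|c m g md IH].
  have -> : evr 0 = 0 by apply/rowP => i; rewrite !mxE meval0 !rmorph0 mul0r.
  by rewrite dehom0 !rmorph0 linear0 mul0mx subrr sub0mx.
have -> : poly_rV (iota (dehom (c *: 'X_[m] + g))) *m top_eval x z d -
    evr (c *: 'X_[m] + g) =
    cst c *: (poly_rV (iota (dehom 'X_[m])) *m top_eval x z d - evr 'X_[m]) +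
    (poly_rV (iota (dehom g)) *m top_eval x z d - evr g).
  rewrite evrP dehomP rmorphD /= map_polyZ /= linearP mulmxDl -scalemxAl.
  exact: scalerB_addrACA.
apply: addmx_sub => //; apply: scalemx_sub.
move: md; rewrite mdegE big_ord3 /= => md.
have dm : (m i0 + m i1 + m i2 = d)%N by [].
have := eval_space_monomial_sub x z tau (m i0) (m i1) (m i2); rewrite dm.
rewrite -eqmx_opp; set u := - _; set v := (_ - _).
suff -> : v = u by [].
have DE : iota (dehom 'X_[m]) = tau ^+ m i1 *: 'X^(m i2).
  by rewrite dehomX rmorphM /= map_polyC map_polyXn /= rmorphXn mul_polyC.
have m2d : (m i2 < d.+1)%N by lia.
apply/rowP => i; rewrite /u /v mxE top_evalE DE poly_rV_K; last first.
  by rewrite (leq_trans (size_scale_leq _ _)) ?size_polyXn.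
rewrite (bigD1 (Ordinal m2d)) //= big1 => [|j jm]; last first.
  by rewrite coefZ coefXn -[_ == m i2]/(j == Ordinal m2d) (negbTE jm) mulr0 mul0r.
rewrite coefZ coefXn eqxx !mxE mevalX big_ord3 /=.
have x1E : 1 + tau * x i = cst (p i 0 i1) / ell i.
  by rewrite /x mulrA -{1}(mulfV (ell_neq0 i)) -mulrDl /ell subrK.
rewrite x1E (_ : (d - m i2 = m i0 + m i1)%N); last by lia.
rewrite -dm !exprD /x /z !exprMn !exprVn !rmorphM !rmorphXn /= !invfM.
by rewrite mulr1 addr0; ring.
Qed.

Let ev (h : dhomog 3 F d) : 'rV[F]_n := \row_i (mpoly_of_dhomog h).@[p i 0].

Let ev_linear : linear ev.
Proof. by move=> c g h; apply/rowP => i; rewrite !mxE mevalD mevalZ. Qed.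

HB.instance Definition _ :=
  GRing.isLinear.Build F (dhomog 3 F d) 'rV[F]_n _ ev ev_linear.

(** V holds the values over F of all forms of degree d, and the rows of [A] are a basis of it moved
    to K and scaled by ell^d. Evaluation kills W, which bounds dim V. *)
Let V : {vspace 'rV[F]_n} := limg (linfun ev).
Let A : 'M[K]_(\dim V, n) := \matrix_(k, i) (cst ((vbasis V)`_k 0 i) / ell i ^+ d).

Let dimV : (\dim V + \dim W <= 'C(d.+2, 2))%N.
Proof.
rewrite -(dim_forms F d) -(limg_ker_dim (linfun ev) fullv) capfv addnC leq_add2r;
  apply: dimvS.
apply/subvP => h hW; rewrite memv_ker lfunE; apply/eqP/rowP => i.
by rewrite !mxE p_vanish.
Qed.

Let evr_sub (h : {mpoly F[3]}) : h \is d.-homog -> (evr h <= A)%MS.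
Proof.
move=> hd; have : ev (DHomog hd) \in V by rewrite -(lfunE ev) memv_img ?memvf.
move=> /coord_vbasis E.
have -> : evr h = \sum_k cst (coord (vbasis V) k (ev (DHomog hd))) *: row k A.
  apply/rowP => i; rewrite mxE summxE.
  have -> : h.@[p i 0] = ev (DHomog hd) 0 i by rewrite mxE.
  rewrite {1}E summxE rmorph_sum rmorph_sum mulr_suml; apply: eq_bigr => k _.
  by rewrite !mxE !rmorphM /= mulrA.
by apply: summx_sub => k _; rewrite scalemx_sub // row_sub.
Qed.

Let evr_shift_sub m : forall e (h : {mpoly F[3]}), (e + m = d)%N -> h \is e.-homog ->
  (\row_i (cst h.@[p i 0] * ell i ^+ m / ell i ^+ d) <= A)%MS.
Proof.
elim: m => [|m IH] e h emd he.
  rewrite addn0 in emd; rewrite emd in he.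
  suff -> : \row_i (cst h.@[p i 0] * ell i ^+ 0 / ell i ^+ d) = evr h by exact: evr_sub.
  by apply/rowP => i; rewrite !mxE expr0 mulr1.
have hX j : h * 'X_j \is e.+1.-homog.
  have Xj : ('X_j : {mpoly F[3]}) \is 1.-homog by rewrite dhomogX /= mdeg1.
  by have := dhomogM he Xj; rewrite addn1.
have em : (e.+1 + m = d)%N by rewrite addSnnS.
have -> : \row_i (cst h.@[p i 0] * ell i ^+ m.+1 / ell i ^+ d) =
    \row_i (cst (h * 'X_i1).@[p i 0] * ell i ^+ m / ell i ^+ d) -
    tau *: \row_i (cst (h * 'X_i0).@[p i 0] * ell i ^+ m / ell i ^+ d).
  apply/rowP => i; rewrite !mxE !mevalM !mevalXU !rmorphM /= exprS {1}/ell.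
  by ring.
by apply: addmx_sub; rewrite ?eqmx_opp ?scalemx_sub //; exact: IH em (hX _).
Qed.

(** A monomial of degree k <= d in x and z, times ell^d, is a form times a power of ell, hence a
    K-combination of forms of degree d over F. So passing to K does not enlarge the dimension beyond
    dim V. *)
Let rank_eval_space : (\rank (eval_space x z d.+1) + \dim W <= 'C(d.+2, 2))%N.
Proof.
apply: leq_trans dimV; rewrite leq_add2r; apply: leq_trans (rank_leq_row A).
apply: mxrankS; suff H k : (k <= d.+1)%N -> (eval_space x z k <= A)%MS by exact: H.
elim: k => [_|k IH kd]; first exact: sub0mx.
rewrite addsmx_sub IH ?(ltnW kd) //=; apply/row_subP => j.
have hd : 'X_[F, mexp (k - j) 0 j] \is k.-homog.
  by rewrite dhomogX /= mdeg_mexp; apply/eqP; have := ltn_ord j; lia.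
have := evr_shift_sub (subnKC (kd : (k <= d)%N)) hd.
suff -> :
    \row_i (cst 'X_[F, mexp (k - j) 0 j].@[p i 0] * ell i ^+ (d - k) / ell i ^+ d) =
    row j (top_eval x z k) by [].
apply/rowP => i; rewrite !mxE mevalX big_ord3 !mnmE /= expr0 mulr1.
have -> : ell i ^+ d = ell i ^+ (d - k) * (ell i ^+ (k - j) * ell i ^+ j).
  by rewrite -!exprD; congr (_ ^+ _); have := ltn_ord j; lia.
rewrite !rmorphM !rmorphXn /= /x /z !expr_div_n.
by field; rewrite !expf_neq0.
Qed.

Lemma coprime_zeros_le (a b : nat) : (b <= a)%N ->
  ('C(a.+1, 2) + b.+1 <= \dim W)%N ->
  (a <= d)%N /\ (n <= (d - a) * d.+1 + (a - b))%N.
Proof.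
move=> ba Wab.
pose P (g : {poly K}) := exists2 h : dhomog 3 F d, h \in W & g = iota (dehom h).
have dim_le : (\rank (eval_space x z d.+1) + ('C(a.+1, 2) + b.+1) <= 'C(d.+2, 2))%N.
  by apply: leq_trans rank_eval_space; rewrite leq_add2l.
apply: (plane_points_bound xz_inj (P := P) _ _ _ _ ba dim_le).
- move=> g [h _ ->]; rewrite size_map_inj_poly ?rmorph0 //.
  exact/size_dehom_le/dhomog_is_dhomog.
(* Members of W have zero values at the points, so by [top_eval_dehom] the values of their leading
   forms come from lower degree. *)
- move=> g [h hW ->]; rewrite lead_spaceE.
  have := top_eval_dehom (dhomog_is_dhomog h).
  by rewrite [evr _](_ : _ = 0) ?subr0 //; apply/rowP => i;
    rewrite !mxE p_vanish // !rmorph0 mul0r.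
- have [h hW h0] := W_vertical; exists (iota (dehom h)); first by exists h.
  rewrite size_map_inj_poly ?rmorph0 //.
  exact: size_dehom_vertical (dhomog_is_dhomog h) h0.
by move=> g gP; apply: W_gcd => h hW; apply: gP; exists h.
Qed.
End CoprimeZeros.

Section MulForm.
Local Open Scope ring_scope.
Variables (F : finFieldType) (d e k : nat) (g : {mpoly F[3]}).
Hypotheses (ek : (e + k = d)%N) (ge : g \is e.-homog).

Lemma mul_form_dhomog (h : dhomog 3 F k) : g * mpoly_of_dhomog h \is d.-homog.
Proof. by rewrite -ek; apply: dhomogM => //; apply: dhomog_is_dhomog. Qed.

Definition mul_form (h : dhomog 3 F k) : dhomog 3 F d := DHomog (mul_form_dhomog h).

Lemma mul_form_linear : linear mul_form.
Proof. by move=> c h h'; apply: val_inj; rewrite /= mulrDr -scalerAr. Qed.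

HB.instance Definition _ :=
  GRing.isLinear.Build F (dhomog 3 F k) (dhomog 3 F d) _ mul_form mul_form_linear.

Hypothesis g0 : g != 0.

Lemma lker_mul_form : lker (linfun mul_form) = 0%VS.
Proof.
apply/eqP; rewrite -subv0; apply/subvP => h.
rewrite memv_ker lfunE memv0 => /eqP/(congr1 (@mpoly_of_dhomog _ _ _))/eqP /=.
by rewrite mulf_eq0 (negbTE g0) -val_eqE.
Qed.

Lemma dim_mul_form (U : {vspace dhomog 3 F k}) : \dim (linfun mul_form @: U) = \dim U.
Proof. by apply: limg_dim_eq; rewrite lker_mul_form capv0. Qed.
End MulForm.

Section UpperBound.
Local Open Scope ring_scope.
Variables (F : finFieldType) (d : nat).
Local Notation q := #|F|.
Local Notation forms := (dhomog 3 F d).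

Lemma norm_zeros_le_vertical (W : {vspace forms}) (f1 : forms) (a b : nat) :
  (0 < d)%N -> (d < q)%N -> f1 \in W -> (mpoly_of_dhomog f1).@[pt 0 0 1] != 0 ->
  (b <= a)%N -> ('C(a.+1, 2) + b.+1 <= \dim W)%N ->
  (#|norm_zeros W| <= (d - a) * q + (a < d) + (a - b))%N.
Proof.
move=> d0 dq f1W f1v ba dW.
pose s := [seq dehom (mpoly_of_dhomog (f : forms)) | f : finvect_type forms in W].
have sW (f : forms) : f \in W -> dehom (mpoly_of_dhomog f) \in s.
  by move=> fW; apply/imageP; exists f.
have [G Gm [Gdvd Ggcd]] :=
  monic_common_divisor (sW f1 f1W) f1v (lead_coef_dehom_vertical (dhomog_is_dhomog f1) f1v).
have [Q1 Q1E] := Gdvd _ (sW f1 f1W).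
pose e := (size G).-1; have sG : size G = e.+1.
  by rewrite -polySpred // monic_neq0.
have [ed Ge Qde] := tdeg_le_factor Gm sG (tdeg_le_dehom (dhomog_is_dhomog f1))
  (size_dehom_vertical (dhomog_is_dhomog f1) f1v) Q1E.
pose g := homogenize e G; have ge : g \is e.-homog := homogenize_dhomog e G.
have gG : dehom g = G := homogenizeK Ge.
have g0 : g != 0.
  by apply: contraTneq Gm => g0;
    rewrite -gG g0 dehom0 monicE lead_coef0 eq_sym oner_eq0.
have edE : (e + (d - e) = d)%N := subnKC ed.
pose mu := linfun (mul_form edE ge).
(* The cofactor Q has total degree at most d - e, so it homogenizes to a form of that degree. *)
have factor (f : forms) Q : f \in W -> dehom (mpoly_of_dhomog f) = G * Q ->
    exists2 h : dhomog 3 F (d - e), mu h = f & dehom (mpoly_of_dhomog h) = Q.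
  move=> fW fE; have Qd : tdeg_le (d - e) Q.
    by apply: Qde; rewrite -fE; apply/tdeg_le_dehom/dhomog_is_dhomog.
  exists (DHomog (homogenize_dhomog (d - e) Q)); last exact: homogenizeK.
  rewrite lfunE; apply: val_inj => /=.
  apply: (dehom_inj (d := d)).
  - by rewrite -[X in X.-homog]edE; apply: dhomogM => //; apply: homogenize_dhomog.
  - exact: dhomog_is_dhomog.
  by rewrite dehomM gG homogenizeK.
pose W2 := (mu @^-1: W)%VS.
have W2W : (mu @: W2)%VS = W.
  apply: lpreimK; apply/subvP => f fW; have [Q fE] := Gdvd _ (sW f fW).
  by have [h <- _] := factor f Q fW fE; rewrite memv_img ?memvf.
have dW2 : \dim W2 = \dim W by rewrite -W2W (dim_mul_form edE ge g0).
have [h1 h1f1 h1Q] := factor f1 Q1 f1W Q1E.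
have h1W : h1 \in W2 by rewrite -memv_preim h1f1.
have h1v : (mpoly_of_dhomog h1).@[pt 0 0 1] != 0.
  apply: contraNneq f1v => h1v; rewrite -h1f1 lfunE /= mevalM h1v mulr0 //.
have [ade n2] : (a <= d - e)%N /\
    (#|norm_zeros W2| <= (d - e - a) * (d - e).+1 + (a - b))%N.
  apply: (coprime_zeros_le (tofrac := @FracField.tofrac {poly F})) => //.
  - exact: tofrac_inj.
  - by exists h1.
  - move=> c cW2; apply: Ggcd => f' Q /imageP[f fW ->] fE.
    have [h hf <-] := factor f Q fW fE; apply: cW2.
    by rewrite -memv_preim hf.
  by rewrite dW2.
have Zsub : norm_zeros W \subset
    [set v : 'rV[F]_3 | (lead v == 1) && (g.@[v 0] == 0)] :|: norm_zeros W2.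
  apply/subsetP => v; rewrite !inE => /andP[-> /vanishP vW] /=.
  have [//|gv] := eqVneq g.@[v 0] 0; apply/vanishP => h hW2 /=.
  have : mu h \in W by rewrite memv_preim.
  move=> /vW; rewrite lfunE /= mevalM => /eqP; rewrite mulf_eq0 (negbTE gv) /=.
  by move=> /eqP.
apply: leq_trans (subset_leq_card Zsub) _; apply: leq_trans (leq_card_setU _ _) _.
(* Here d < q enters, through d - e + 1 <= q. *)
have {}n2 : (#|norm_zeros W2| <= (d - e - a) * q + (a - b))%N.
  by apply: leq_trans n2 _;
    rewrite leq_add2r leq_mul2l (leq_ltn_trans (leq_subr e d) dq) orbT.
have dae : (d - a = e + (d - e - a))%N by move: ade ed; clear; lia.
(* For e = 0 the common factor is 1 and has no zeros. For e > 0 we have a <= d - e < d, so the extra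
   point of Serre's bound is the summand [a < d]. *)
rewrite dae mulnDl; have [e0|e0] := posnP e.
  suff -> : #|[set v : 'rV[F]_3 | (lead v == 1) && (g.@[v 0] == 0)]| = 0%N.
    rewrite add0n (leq_trans n2) // leq_add2r -addnA addnCA.
    exact: leq_addr.
  have /size_poly1P[c _ Gc] : size G == 1%N by rewrite sG e0.
  have g1 : g = 1.
    apply: (dehom_inj (d := 0)); [by rewrite -[X in X.-homog]e0 | exact: dhomog1 |].
    have := monicP Gm; rewrite gG Gc lead_coefC => ->.
    by rewrite /dehom !rmorph1.
  apply/eqP; rewrite cards_eq0; apply/eqP/setP => v.
  by rewrite !inE g1 meval1 oner_eq0 andbF.
have gz : (#|[set v : 'rV[F]_3 | (lead v == 1%R) && (g.@[v 0%R] == 0%R)]| <= e * q + 1)%N.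
  by apply: form_zeros_le => //; rewrite e0 (leq_trans ed) // ltnW.
have ad : (a < d)%N by move: ade e0 ed; clear; lia.
rewrite ad; apply: leq_trans (leq_add gz n2) _.
by move: (e * q)%N (_ * q)%N => u v; clear; lia.
Qed.

Lemma norm_zeros_le (W : {vspace forms}) (a b : nat) :
  (0 < d)%N -> (d < q)%N -> (b <= a)%N -> ('C(a.+1, 2) + b.+1 <= \dim W)%N ->
  (#|norm_zeros W| <= (d - a) * q + (a < d) + (a - b))%N.
Proof.
move=> d0 dq ba dW; have W0 : W != 0%VS.
  by rewrite -dimv_eq0 -lt0n (leq_trans _ dW) // addnS.
pose f := vpick W; have f0 : mpoly_of_dhomog f != 0.
  by have := W0; rewrite -vpick0 -val_eqE.
have fd := dhomog_is_dhomog f.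
(* By Serre's bound f has at most d q + 1 zeros, fewer than the q^2 + q + 1 points of the plane. *)
have [P lP fP] : exists2 P : 'rV[F]_3, lead P = 1 & (mpoly_of_dhomog f).@[P 0] != 0.
  have dq' : (0 < d <= q)%N by rewrite d0 ltnW.
  have := form_zeros_le fd f0 dq'; set Z := [set v | _] => Zle.
  have : ~~ ([set v | lead v == 1] \subset Z).
    apply: contraL Zle => /subset_leq_card; rewrite card_norm_points -ltnNge.
    apply: leq_trans; rewrite -mulnn; move: dq; clear.
    by move: #|F| => Q; nia.
  case/subsetPn => P; rewrite !inE => /eqP lP; rewrite lP eqxx => fP.
  by exists P.
have [M Mu MP] := move_point (ptrow001_neq0 F) (lead1_neq0 (introT eqP lP)).
rewrite -(card_norm_zeros_vsubst W Mu).
apply: (norm_zeros_le_vertical (f1 := form_subst M f)) => //;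
  last by rewrite dim_vsubst.
  by rewrite -(lfunE (form_subst M)) memv_img ?memv_pick.
rewrite /= (meval_eq (v2 := (ptrow 0 0 1) 0)) => [|i]; last by rewrite ptrowE.
by rewrite meval_subst MP.
Qed.
End UpperBound.

(** * The lower bound *)

Section LowerBound.
Local Open Scope ring_scope.
Variables (F : finFieldType).
Local Notation q := #|F|.
Local Notation i0 := (ord0 : 'I_3).
Local Notation i1 := (lift ord0 ord0 : 'I_3).

Definition pencil (s : seq F) : {mpoly F[3]} := \prod_(c <- s) ('X_i1 - c *: 'X_i0).

Lemma pencil_dhomog s : pencil s \is (size s).-homog.
Proof.
rewrite /pencil; elim: s => [|c s IH]; first by rewrite big_nil; apply: dhomog1.
rewrite big_cons -[size _]add1n; apply: dhomogM IH.
have X1 j : ('X_j : {mpoly F[3]}) \is 1.-homog by rewrite dhomogX /= mdeg1.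
by apply: rpredB; rewrite ?rpredZ.
Qed.

Lemma meval_pencil s (v : 'I_3 -> F) : (pencil s).@[v] = \prod_(c <- s) (v i1 - c * v i0).
Proof.
rewrite /pencil rmorph_prod; apply: eq_bigr => c _ /=.
by rewrite mevalB mevalZ !mevalXU.
Qed.

Lemma pencil_neq0 s : pencil s != 0.
Proof.
apply/eqP => /(congr1 (meval (pt 0 1 0))); rewrite meval_pencil meval0.
by rewrite big1 => [/eqP|c _]; rewrite ?oner_eq0 // /pt /= mulr0 subr0.
Qed.

(** Each line x1 = c x0 has q points besides (0 : 0 : 1), and these are distinct for distinct c; the
    common point counts once if there is a line. *)
Lemma pencil_zeros_ge s : uniq s ->
  (size s * q + (0 < size s) <=
   #|[set v : 'rV[F]_3 | (lead v == 1%R) && ((pencil s).@[v 0%R] == 0%R)]|)%N.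
Proof.
move=> us; rewrite (card_points (fun v => (pencil s).@[v 0] == 0)).
apply: leq_add; last first.
  case: s us => [|c s] us //=; rewrite meval_pencil big_cons !mxE /pt /=.
  by rewrite mulr0 subrr mul0r eqxx.
apply: leq_trans (leq_addr _ _).
have -> : (size s * q = \sum_(a : F | a \in s) q)%N.
  by rewrite sum_nat_const (card_uniqP us).
rewrite big_mkcond; apply: leq_sum => a _; case: ifP => // aS.
rewrite -[X in (X <= _)%N]muln1 -sum_nat_const; apply: leq_sum => b _.
by rewrite meval_pencil (big_rem a) //= !mxE /pt /= mulr1 subrr mul0r eqxx.
Qed.

Lemma subspace_of_dim (vT : vectType F) (U : {vspace vT}) (r : nat) :
  (r <= \dim U)%N -> exists2 W : {vspace vT}, (W <= U)%VS & \dim W = r.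
Proof.
move=> rU; exists <<take r (vbasis U)>>%VS.
  by apply/span_subvP => v /mem_take; apply: vbasis_mem.
have : free (take r (vbasis U) ++ drop r (vbasis U)).
  by rewrite cat_take_drop (basis_free (vbasisP U)).
by move=> /catl_free/eqP->; rewrite size_take_min size_tuple; apply/minn_idPl.
Qed.

Section EvalSeq.
Variables (a : nat) (xs : seq 'rV[F]_3).

Definition eval_seq (h : dhomog 3 F a) : 'rV[F]_(size xs) :=
  \row_i (mpoly_of_dhomog h).@[(nth 0 xs i) 0].

Lemma eval_seq_linear : linear eval_seq.
Proof. by move=> c g h; apply/rowP => i; rewrite !mxE mevalD mevalZ. Qed.

HB.instance Definition _ :=
  GRing.isLinear.Build F (dhomog 3 F a) 'rV[F]_(size xs) _ eval_seq eval_seq_linear.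

Lemma dim_eval_seq_ker : ('C(a.+2, 2) <= \dim (lker (linfun eval_seq)) + size xs)%N.
Proof.
rewrite -(dim_forms F a) -(limg_ker_dim (linfun eval_seq) fullv) capfv leq_add2l.
apply: leq_trans (dimvS (subvf _)) _; rewrite dimvf.
by rewrite /dim /= mul1n.
Qed.

Lemma eval_seq_ker h v : h \in lker (linfun eval_seq) -> v \in xs ->
  (mpoly_of_dhomog h).@[v 0] = 0.
Proof.
rewrite memv_ker lfunE => /eqP/rowP hx vx.
have vi : (index v xs < size xs)%N by rewrite index_mem.
by have := hx (Ordinal vi); rewrite !mxE /= nth_index.
Qed.
End EvalSeq.

Lemma norm_zeros_ge (d a b : nat) : (d < q)%N -> (b <= a)%N -> (a <= d)%N ->
  exists2 W : {vspace dhomog 3 F d}, \dim W = ('C(a.+1, 2) + b.+1)%N &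
    ((d - a) * q + (a < d) + (a - b) <= #|norm_zeros W|)%N.
Proof.
move=> dq ba ad.
pose s := take (d - a) (enum F).
have us : uniq s by apply: take_uniq; apply: enum_uniq.
have ss : size s = (d - a)%N.
  rewrite size_take_min -cardE; apply/minn_idPl.
  by rewrite (leq_trans (leq_subr _ _)) // ltnW.
have gd : pencil s \is (d - a).-homog by rewrite -ss pencil_dhomog.
set g := pencil s in gd.
pose Z := [set v : 'rV[F]_3 | (lead v == 1) && (g.@[v 0] == 0)].
have Zge : ((d - a) * q + (a < d) <= #|Z|)%N.
  by have := pencil_zeros_ge us; rewrite ss subn_gt0.
pose N := [set v : 'rV[F]_3 | lead v == 1].
(* If fewer than a - b points remain outside Z, all of them are taken; the zeros are then the whole
   plane, whose q^2 + q + 1 points suffice as well. *)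
pose xs := take (a - b) (enum (N :\: Z)).
have xsE : size xs = minn (a - b) #|N :\: Z|.
  by rewrite size_take_min -cardE.
pose mu := linfun (mul_form (subnK ad) gd).
pose U := (mu @: lker (linfun (@eval_seq a xs)))%VS.
(* At most a - b linear conditions on forms of degree a leave dimension at least C(a + 2, 2) - (a -
   b) = C(a + 1, 2) + b + 1. *)
have [|W WU dW] := @subspace_of_dim _ U ('C(a.+1, 2) + b.+1).
  rewrite dim_mul_form ?pencil_neq0 //.
  have := dim_eval_seq_ker a xs; rewrite bin2_split; move: xsE ba.
  move: (\dim (lker _)) => u; move: (size xs) 'C(_, 2) #|_| => m v w; clear; lia.
exists W => //.
have sub : Z :|: [set v in xs] \subset norm_zeros W.
  apply/subsetP => v; rewrite !inE => vZ; apply/andP; split.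
    case/orP: vZ => [/andP[]//|/mem_take]; rewrite mem_enum !inE.
    by move=> /andP[].
  apply/vanishP => f /(subvP WU)/memv_imgP[h hk ->]; rewrite lfunE /= mevalM.
  case/orP: vZ => [/andP[_ /eqP->]|vx]; first by rewrite mul0r.
  by rewrite (eval_seq_ker hk vx) mulr0.
apply: leq_trans (subset_leq_card sub).
rewrite cardsU (_ : _ :&: _ = set0) ?cards0 ?subn0; last first.
  apply/setP => v; rewrite !inE; apply/negP => /andP[vZ /mem_take].
  by rewrite mem_enum !inE vZ.
have -> : #|[set v in xs]| = size xs.
  by rewrite cardsE; apply/card_uniqP/take_uniq/enum_uniq.
rewrite xsE.
have : (#|N| <= #|Z| + #|N :\: Z|)%N.
  by rewrite -(cardsID Z N) leq_add2r subset_leq_card // subsetIr.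
rewrite card_norm_points; move: #|_ :\: _| #|Z| Zge => u w Zge.
clear -Zge ba ad dq; rewrite -mulnn; move: #|F| dq Zge => Q dq Zge.
have : ((d - a) * Q + (a < d) + (a - b) <= Q * Q + Q + 1)%N by nia.
lia.
Qed.

End LowerBound.

(** * The value f_r(d, 2; q) *)

Import Order.TTheory.

Section LexOrder.
Variable e : nat.

Lemma sort_Omega (m : nat) (L : seq (m.+1.-tuplelexi 'I_e.+1)) :
  pairwise (fun u v => (v < u)%O) L -> (forall u, (u \in Omega e m) = (u \in L)) ->
  sort >=%O (enum (Omega e m)) = L.
Proof.
move=> Lp LO.
have lt_tr : transitive (fun u v : m.+1.-tuplelexi 'I_e.+1 => (v < u)%O).
  by move=> u v w vu uw; apply: lt_trans uw vu.
have Ls : sorted (fun u v => (v < u)%O) L by rewrite sorted_pairwise.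
apply: (sorted_eq (leT := >=%O)).
- by move=> u v w vu uw; apply: le_trans uw vu.
- by move=> u v /andP[uv vu]; apply/eqP; rewrite eq_le; apply/andP.
- by apply: sort_sorted => u v; apply: le_total.
- by apply: sub_sorted Ls => u v /ltW.
rewrite perm_sort; apply: uniq_perm; first exact: enum_uniq.
  by apply: (sorted_uniq lt_tr _ Ls) => u; apply: ltxx.
by move=> u; rewrite mem_enum LO.
Qed.

Definition lex2 (b : nat) : 2.-tuplelexi 'I_e.+1 := [tuple inord (e - b); inord b].

(** In these parameters the decreasing lexicographic order runs through increasing a, then
    increasing b. The block of a has a + 1 elements, so (a, b) has index C(a + 1, 2) + b, counted
    from 0. *)
Definition lex3 (a b : nat) : 3.-tuplelexi 'I_e.+1 :=
  [tuple inord (e - a); inord (a - b); inord b].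

Fixpoint lex3_seq (a : nat) : seq (3.-tuplelexi 'I_e.+1) :=
  if a is a'.+1 then lex3_seq a' ++ [seq lex3 a' b | b <- iota 0 a] else [::].

Lemma lex3_seqS a : lex3_seq a.+1 = lex3_seq a ++ [seq lex3 a b | b <- iota 0 a.+1].
Proof. by []. Qed.

Lemma size_lex3_seq a : size (lex3_seq a) = 'C(a.+1, 2).
Proof.
elim: a => // a IH.
by rewrite lex3_seqS size_cat IH size_map size_iota [RHS]bin2_split.
Qed.

Lemma nth_lex3_seq u a b n : b <= a < n ->
  nth u (lex3_seq n) ('C(a.+1, 2) + b) = lex3 a b.
Proof.
case/andP=> ba; elim: n => // n IH; rewrite ltnS leq_eqVlt => /orP[/eqP an|an].
  subst n; rewrite lex3_seqS nth_cat size_lex3_seq ltnNge leq_addr addKn.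
  by rewrite (nth_map 0) ?size_iota // nth_iota.
rewrite lex3_seqS nth_cat size_lex3_seq (leq_trans _ (leq_bin2 (an : a.+1 < n.+1))) ?IH //.
by rewrite (bin2_split a.+1) ltn_add2l.
Qed.

Lemma mem_lex3_seq u n :
  reflect (exists a b, [/\ b <= a, a < n & u = lex3 a b]) (u \in lex3_seq n).
Proof.
apply: (iffP idP); last first.
  move=> [a [b [ba an ->]]];
    rewrite -(nth_lex3_seq u (a := a) (b := b) (n := n)) ?ba //.
  rewrite mem_nth // size_lex3_seq (leq_trans _ (leq_bin2 (an : a.+1 < n.+1))) //.
  by rewrite (bin2_split a.+1) ltn_add2l.
elim: n => // n IH; rewrite lex3_seqS mem_cat => /orP[/IH[a [b [ba an ->]]]|/mapP[b]].
  by exists a, b; rewrite ba ltnW.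
by rewrite mem_iota => /andP[_ bn] ->; exists n, b.
Qed.

Lemma lex3_lt a b a' b' : b <= a -> b' <= a' -> a' <= e ->
  a < a' \/ a = a' /\ b < b' -> (lex3 a' b' < lex3 a b)%O.
Proof.
move=> ba ba' ae H; apply/ltxi_tuplePlt; case: H => [aa|[-> bb]].
  exists ord0 => //; rewrite ltEord /= !(tnth_nth ord0) /= !inordK; lia.
exists (lift ord0 ord0) => [i|].
  by case: i => -[|i] //= _ _; rewrite !(tnth_nth ord0).
rewrite ltEord /= !(tnth_nth ord0) /= !inordK; lia.
Qed.

Lemma lex3_seq_pairwise n : n <= e.+1 -> pairwise (fun u v => (v < u)%O) (lex3_seq n).
Proof.
elim: n => // n IH ne; rewrite lex3_seqS pairwise_cat IH ?(ltnW ne) // andTb;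
  apply/andP; split.
  apply/allrelP => u v /mem_lex3_seq[a [b [ba an ->]]] /mapP[b'].
  by rewrite mem_iota => /andP[_ bn] ->; apply: lex3_lt => //; left.
rewrite pairwise_map.
apply/(pairwiseP 0) => i j; rewrite !inE size_iota => ilt jlt ij.
by rewrite !nth_iota //=; apply: lex3_lt => //; right.
Qed.

Lemma sort_Omega2 : sort >=%O (enum (Omega e 2)) = lex3_seq e.+1.
Proof.
apply: sort_Omega => [|u]; first exact: lex3_seq_pairwise.
apply/idP/mem_lex3_seq; rewrite inE !big_ord_recl big_ord0 addn0.
  case: u => -[|x [|y [|z []]]] //= us; rewrite !(tnth_nth ord0) /= => /eqP xyz.
  exists (e - x), z; split; [lia|lia|]; apply/val_inj => /=.
  by congr [:: _; _; _]; apply/val_inj; rewrite /= inordK; lia.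
case=> a [b [ba ae ->]]; rewrite !(tnth_nth ord0) /= !inordK; lia.
Qed.

Lemma sort_Omega1 : sort >=%O (enum (Omega e 1)) = [seq lex2 b | b <- iota 0 e.+1].
Proof.
apply: sort_Omega => [|u].
  rewrite pairwise_map; apply/(pairwiseP 0) => i j;
    rewrite !inE size_iota => ilt jlt ij.
  rewrite !nth_iota //=; apply/ltxi_tuplePlt; exists ord0 => //.
  by rewrite ltEord /= !(tnth_nth ord0) /= !inordK; lia.
apply/idP/mapP; rewrite inE !big_ord_recl big_ord0 addn0.
  case: u => -[|x [|y []]] //= us; rewrite !(tnth_nth ord0) /= => /eqP xy.
  have ye : nat_of_ord y \in iota 0 e.+1 by rewrite mem_iota; have := ltn_ord y; lia.
  exists (nat_of_ord y); first exact: ye.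
  apply/val_inj => /=.
  by congr [:: _; _]; apply/val_inj; rewrite /= inordK; lia.
case=> b; rewrite mem_iota => bb ->; rewrite !(tnth_nth ord0) /= !inordK; lia.
Qed.

Lemma H_val2 a b q : b <= a <= e ->
  H_val ('C(a.+1, 2) + b.+1) e 2 q = (e - a) * q + (a - b).
Proof.
case/andP=> ba ae; rewrite /H_val.
have -> : omega ('C(a.+1, 2) + b.+1) e 2 = lex3 a b.
  by rewrite /omega sort_Omega2 addnS; apply: nth_lex3_seq; rewrite ba.
rewrite big_nat_recl // big_nat1 /= !inordK ?expn1 ?expn0 ?muln1 //; lia.
Qed.

Lemma H_val1 b q : b <= e -> H_val b.+1 e 1 q = e - b.
Proof.
move=> be; rewrite /H_val; have -> : omega b.+1 e 1 = lex2 b.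
  by rewrite /omega sort_Omega1 (nth_map 0) ?size_iota // nth_iota.
by rewrite big_nat1 /= inordK ?expn0 ?muln1 //; lia.
Qed.

End LexOrder.

(** The level is 1 for a < d, 2 for a = d and b < d, and 3 for a = b = d. In the first case pi_1 = q
    + 1 raises (d - 1 - a) q to (d - a) q + 1; in the second pi_0 = 1 raises d - 1 - b to d - b; in
    the third both terms are 0. *)
Lemma f_valE (a b d q : nat) : 0 < d -> 1 < q -> b <= a <= d ->
  f_val ('C(a.+1, 2) + b.+1) d 2 q = (d - a) * q + (a < d) + (a - b).
Proof.
case: d => // d _ q1 /andP[ba ad].
have bd : 'C(2 + d.+1, d.+1) = 'C(d.+2, 2) + d.+2.
  by rewrite -bin2_split -bin_sub ?leq_addl // addnK !addSn.
have bd1 : 'C(d.+2, d.+1) = d.+2 by rewrite -bin_sub // subSnn bin1.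
have pi1 : pi_proj (Posz 1) q = q.+1.
  rewrite -[LHS]/((q ^ 2 - 1) %/ (q - 1)).
  have -> : q ^ 2 - 1 = (q - 1) * q.+1 by rewrite -mulnn; nia.
  by rewrite mulKn // subn_gt0.
have pi0 : pi_proj (Posz 0) q = 1.
  by rewrite -[LHS]/((q ^ 1 - 1) %/ (q - 1)) expn1 divnn subn_gt0 q1.
have b1 : 'C(2 + d.+1 + 1 - 1, d.+1) = 'C(d.+2, 2) + d.+2 by rewrite addnK.
have b2 : 'C(2 + d.+1 - 1, d.+1) = d.+2 by rewrite -bd1.
have b2' : 'C(2 + d.+1 + 1 - 2, d.+1) = d.+2 by rewrite (_ : _ - _ = d.+2) //; lia.
have b3 : 'C(2 + d.+1 - 2, d.+1) = 1 by rewrite (_ : _ - _ = d.+1) ?binn //; lia.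
have b3' : 'C(2 + d.+1 + 1 - 3, d.+1) = 1 by rewrite (_ : _ - _ = d.+1) ?binn //; lia.
have b4 : 'C(2 + d.+1 - 3, d.+1) = 0 by rewrite bin_small //; lia.
rewrite /f_val; have [ad'|ad'] := leqP a d.
  have rN : 'C(a.+1, 2) + b.+1 <= 'C(d.+2, 2).
    apply: (@leq_trans 'C(a.+2, 2)); first by rewrite (bin2_split a.+1) leq_add2l.
    exact: leq_bin2.
  have -> : level ('C(a.+1, 2) + b.+1) d.+1 2 = 1.
    rewrite /level (_ : iota 1 3 = [:: 1; 2;
      3]) // [filter _ _]/= bd b1 b2 subnn addnK.
    by rewrite rN addnS.
  rewrite bd b1 subnn subn0 -[2 + 1 - 1]/2 -[d.+1 - 1]/(d - 0) subn0 H_val2 ?ba //.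
  rewrite -[(_ - _)%R]/(Posz 1) pi1 ltnS ad' subSn // mulSn; lia.
have {ad ad'} ea : a = d.+1 by lia.
subst a; have [bd'|bd'] := leqP b d.
  have -> : level ('C(d.+2, 2) + b.+1) d.+1 2 = 2.
    rewrite /level (_ : iota 1 3 = [:: 1; 2;
      3]) // [filter _ _]/= bd b1 b2 b2' b3 b3' b4.
    move: 'C(d.+2, 2) => N.
    rewrite (_ : (_ < _ <= N + d.+2 - d.+2) = false); last by apply/negbTE; lia.
    by rewrite (_ : (_ < _ <= N + d.+2 - 1) = true) //; lia.
  rewrite bd b2' -[2 + 1 - 2]/1 -[d.+1 - 1]/(d - 0) subn0 addnK addKn H_val1 //.
  rewrite -[(_ - _)%R]/(Posz 0) pi0 ltnn subnn mul0n !add0n; lia.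
have eb : b = d.+1 by lia.
have -> : level ('C(d.+2, 2) + b.+1) d.+1 2 = 3.
  rewrite /level (_ : iota 1 3 = [:: 1; 2;
    3]) // [filter _ _]/= bd b1 b2 b2' b3 b3' b4 eb.
  move: 'C(d.+2, 2) => N.
  rewrite (_ : (_ < _ <= N + d.+2 - d.+2) = false); last by apply/negbTE; lia.
  rewrite (_ : (_ < _ <= N + d.+2 - 1) = false); last by apply/negbTE; lia.
  by rewrite (_ : (_ < _ <= N + d.+2 - 0) = true) //; lia.
by rewrite bd b3' eb /H_val big_geq // subnn ltnn mul0n.
Qed.

Lemma triangular_decomposition (d r : nat) : 0 < r <= 'C(d.+2, 2) ->
  exists a b, b <= a <= d /\ r = 'C(a.+1, 2) + b.+1.
Proof.
elim: d => [|d IH] /andP[r0 rd].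
  by exists 0, 0; split=> //; move: rd; rewrite (@bin_small 1) // binn; lia.
have [rd'|rd'] := leqP r 'C(d.+2, 2).
  have [|a [b [/andP[ba ad] ->]]] := IH; first by rewrite r0.
  by exists a, b; rewrite ba ltnW.
exists d.+1, (r - 'C(d.+2, 2)).-1; split; last by lia.
by move: rd; rewrite bin2_split; lia.
Qed.

Theorem theorem1p5 (F : finFieldType) (q d r : nat) :
  #|F| = q ->
  0 < d -> 1 <= r <= 'C(d + 2, 2) ->
  d + 1 <= q ->
  e_max F r d 2 = f_val r d 2 q.
Proof.
move=> <- d0; rewrite addn2 addn1 => rd dq.
have [a [b [/andP[ba ad] rE]]] := @triangular_decomposition d r rd.
have q1 : 1 < #|F| by apply: leq_trans dq.
rewrite rE f_valE ?ba // /e_max; apply/eqP; rewrite eqn_leq; apply/andP; split.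
  apply/bigmax_leqP => W /eqP dW; rewrite card_zero_locus.
  by apply: norm_zeros_le; rewrite ?dW.
have [W dW Wge] := @norm_zeros_ge F d a b dq ba ad.
rewrite (leq_trans Wge) // -card_zero_locus.
by apply: (leq_bigmax_cond (F := fun W => #|zero_locus W|)); rewrite dW.
Qed.
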